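(* Let $P,Q\subset\mathbb{R}^3$ each be either an equiprojective polytope, a polygon, or a line segment, and assume $P+Q$ is $3$-dimensional. Then the Minkowski sum $P+Q$ is equiprojective if and only if, for each edge direction $u$ shared by $P$ and $Q$, either (i) $C_P(u)=u^\perp$ or $C_Q(u)=u^\perp$, or (ii) $C_P(u)=C_Q(u)$ or $C_P(u)=-C_Q(u)$.
   Context: A $3$-dimensional polytope $P\subset\mathbb{R}^3$ is $k$-equiprojective when its orthogonal projection onto any plane not orthogonal to a facet of $P$ is a polygon with exactly $k$ vertices; equiprojective means $k$-equiprojective for some $k$. For a polytope $P\subset\mathbb{R}^3$ (of any dimension) and a face $F$, $N_P(F)=\{u\in\mathbb{R}^3:\ u\cdot x\le u\cdot y\ \forall x\in P, y\in F\}$. For non-zero $u$, the aggregated cone $C_P(u)$ is the union of the $2$-dimensional normal cones of $P$ contained in the plane $u^\perp$. A vector $u\in\mathbb{S}^2$ is an edge direction of $P$ when its first non-zero coordinate is positive and some edge of $P$ has difference of vertices a multiple of $u$. *)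

(* Defs.v *)
From HB Require Import structures.
From mathcomp Require Import all_boot all_order all_algebra.
From mathcomp Require Import reals.
Set Implicit Arguments. Unset Strict Implicit. Unset Printing Implicit Defensive.
Import Order.TTheory GRing.Theory Num.Theory.
Local Open Scope ring_scope.

Section Defs.
Variable R : realType.
Notation pt := 'rV[R]_3.

Definition pset := pt -> Prop.

Definition dot (u x : pt) : R := \sum_(i < 3) u 0 i * x 0 i.

Definition seteq (A B : pset) : Prop := forall x, A x <-> B x.

Definition conv (s : seq pt) : pset := fun x =>
  exists w : 'I_(size s) -> R,
    (forall i, 0 <= w i) /\ \sum_i w i = 1 /\ x = \sum_i w i *: s`_i.

Definition polytope (P : pset) : Prop :=
  exists s : seq pt, s != [::] /\ seteq P (conv s).

Definition minkowski (P Q : pset) : pset := fun z =>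
  exists x y, P x /\ Q y /\ z = x + y.

Definition dim_ge (S : pset) (k : nat) : Prop :=
  exists p : 'I_k.+1 -> pt, (forall i, S (p i)) /\
    row_free (\matrix_(i < k) (p (lift ord0 i) - p ord0)).

Definition pdim (S : pset) (k : nat) : Prop := dim_ge S k /\ ~ dim_ge S k.+1.

(* non-empty faces of P (all faces of a polytope are exposed) *)
Definition face (P F : pset) : Prop :=
  exists u : pt, seteq F (fun x => P x /\ forall y, P y -> dot u y <= dot u x).

Definition vertex (S : pset) (x : pt) : Prop :=
  S x /\ exists u : pt, forall y, S y -> y <> x -> dot u y < dot u x.

Definition facet (P F : pset) : Prop := face P F /\ pdim F 2.
Definition edge (P F : pset) : Prop := face P F /\ pdim F 1.

(* the plane n^perp is orthogonal to the facet F: n is parallel to the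
   affine plane of F *)
Definition plane_orth_facet (n : pt) (F : pset) : Prop :=
  exists (w : pt) (c : R), w != 0 /\ dot w n = 0 /\ forall x, F x -> dot w x = c.

Definition proj (n x : pt) : pt := x - (dot n x / dot n n) *: n.
Definition proj_set (n : pt) (P : pset) : pset := fun y =>
  exists x, P x /\ y = proj n x.

Definition has_nvertices (S : pset) (k : nat) : Prop :=
  exists s : seq pt, uniq s /\ size s = k /\ forall x, vertex S x <-> x \in s.

Definition k_equiprojective (P : pset) (k : nat) : Prop :=
  polytope P /\ pdim P 3 /\
  forall n : pt, n != 0 ->
    (~ exists F, facet P F /\ plane_orth_facet n F) ->
    has_nvertices (proj_set n P) k.

Definition equiprojective (P : pset) : Prop := exists k, k_equiprojective P k.

Definition normal_cone (P F : pset) : pset := fun u =>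
  forall x y, P x -> F y -> dot u x <= dot u y.

Definition orth_plane (u : pt) : pset := fun v => dot u v = 0.

Definition agg_cone (P : pset) (u : pt) : pset := fun v =>
  exists F, face P F /\ pdim (normal_cone P F) 2 /\
    (forall w, normal_cone P F w -> orth_plane u w) /\ normal_cone P F v.

Definition neg_set (A : pset) : pset := fun v => A (- v).

Definition first_nonzero_pos (u : pt) : Prop :=
  0 < u 0 0 \/ (u 0 0 = 0 /\ 0 < u 0 1) \/
  (u 0 0 = 0 /\ u 0 1 = 0 /\ 0 < u 0 2).

Definition edge_direction (P : pset) (u : pt) : Prop :=
  dot u u = 1 /\ first_nonzero_pos u /\
  exists E a b (l : R), edge P E /\ E a /\ E b /\ vertex P a /\ vertex P b /\
    a <> b /\ b - a = l *: u.

Definition admissible (P : pset) : Prop :=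
  polytope P /\ (equiprojective P \/ pdim P 2 \/ pdim P 1).

End Defs.

(* Main.v *)
Require Import Defs.
From HB Require Import structures.
From mathcomp Require Import all_boot all_order all_algebra.
From mathcomp Require Import reals.
From mathcomp Require Import ring lra.
Import Order.TTheory GRing.Theory Num.Theory.
Local Open Scope ring_scope.
Set Implicit Arguments. Unset Strict Implicit. Unset Printing Implicit Defensive.

(* Write P = conv s. The projection of a 3-polytope P along n has as many vertices
   as edges, and its edges of direction u are counted by f_u(u x n), where f_u(v) is
   the number of vectors among v and -v that lie in C_P(u). Hence P is equiprojective
   as soon as every f_u is constant on generic vectors of u^perp. Conversely, compare
   the projections along u + e m and u - e m for small e > 0 and m orthogonal to u:
   the total contribution of the directions other than u does not depend on m,
   so 2 f_u(u x m) does not either. Polygons and segments also have constant f_u.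
   Since C_{P+Q}(u) is the union of C_P(u) and C_Q(u) up to nongeneric vectors, what
   remains is to decide, for f_u of P and Q both constant, when the f_u of the union
   is constant; if neither cone is all of u^perp, each one is a.e. the complement of
   its opposite, and this happens exactly when the cones agree up to sign. *)

(** For an edge direction u of a 3-polytope, equiprojectivity says nothing about the view along u
    itself, because the facets at such an edge are parallel to u. Only nearby views u + e m are
    available. There another direction u' is seen with normals close to u' x u and its opposite, and
    these may expose a facet parallel to both u and u'. Which edges of that facet count then depends
    on the side to which m tips the view. Using m and -m together realises every such tie in both
    ways, which is why the resulting equation is for 2 f_u. Faces are handled as finite lists of
    generators maximising a linear form. An infinitesimal change of the form becomes a lexicographic
    maximum, and limits reduce to finitely many conditions on small e. Generic vectors determine the
    aggregated cones exactly: each cone is a finite union of closed two-dimensional convex cones,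
    and in each of these the generic vectors are dense. *)

(** * Dot and cross products in three-space *)

Section Vectors.
Variable R : realType.
Notation pt := 'rV[R]_3.
Implicit Types (u v w x y z : pt) (a b c k : R).

Lemma dotE u x : dot u x = u 0 0 * x 0 0 + u 0 1 * x 0 1 + u 0 2 * x 0 2.
Proof.
rewrite /dot !big_ord_recl big_ord0 addr0 addrA.
by congr (_ * _ + _ * _ + _ * _); congr (_ _ _); apply/val_inj.
Qed.

Lemma vecP x y :
  x 0 0 = y 0 0 -> x 0 1 = y 0 1 -> x 0 2 = y 0 2 -> x = y.
Proof.
move=> h0 h1 h2; apply/rowP => -[[|[|[|//]]] hi].
- by rewrite (_ : Ordinal hi = 0) //; apply/val_inj.
- by rewrite (_ : Ordinal hi = 1) //; apply/val_inj.
- by rewrite (_ : Ordinal hi = 2) //; apply/val_inj.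
Qed.

Definition cross u v : pt := \row_i
  if i == 0 then u 0 1 * v 0 2 - u 0 2 * v 0 1
  else if i == 1 then u 0 2 * v 0 0 - u 0 0 * v 0 2
  else u 0 0 * v 0 1 - u 0 1 * v 0 0.

Lemma cross0E u v : cross u v 0 0 = u 0 1 * v 0 2 - u 0 2 * v 0 1.
Proof. by rewrite mxE. Qed.
Lemma cross1E u v : cross u v 0 1 = u 0 2 * v 0 0 - u 0 0 * v 0 2.
Proof. by rewrite mxE. Qed.
Lemma cross2E u v : cross u v 0 2 = u 0 0 * v 0 1 - u 0 1 * v 0 0.
Proof. by rewrite mxE. Qed.

Lemma addE x y i : (x + y) 0 i = x 0 i + y 0 i. Proof. by rewrite mxE. Qed.
Lemma oppE x i : (- x) 0 i = - x 0 i. Proof. by rewrite mxE. Qed.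
Lemma scaleE k x i : (k *: x) 0 i = k * x 0 i. Proof. by rewrite mxE. Qed.
Lemma zeroE i : (0 : pt) 0 i = 0. Proof. by rewrite mxE. Qed.

Definition coordE := (dotE, cross0E, cross1E, cross2E, addE, oppE, scaleE, zeroE).

Ltac vring := first [apply/vecP; rewrite !coordE; ring | rewrite !coordE; ring].

Lemma dotC u v : dot u v = dot v u. Proof. vring. Qed.
Lemma dotDl u v x : dot (u + v) x = dot u x + dot v x. Proof. vring. Qed.
Lemma dotDr u v x : dot x (u + v) = dot x u + dot x v. Proof. vring. Qed.
Lemma dotNl u x : dot (- u) x = - dot u x. Proof. vring. Qed.
Lemma dotNr u x : dot x (- u) = - dot x u. Proof. vring. Qed.
Lemma dotBr u v x : dot x (u - v) = dot x u - dot x v. Proof. vring. Qed.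
Lemma dotZl k u x : dot (k *: u) x = k * dot u x. Proof. vring. Qed.
Lemma dotZr k u x : dot x (k *: u) = k * dot x u. Proof. vring. Qed.
Lemma dot0l x : dot 0 x = 0. Proof. vring. Qed.
Lemma dot0r x : dot x 0 = 0. Proof. vring. Qed.

Definition dotlE := (dotDl, dotDr, dotNl, dotNr, dotZl, dotZr, dot0l, dot0r).

Lemma crossC u v : cross u v = - cross v u. Proof. vring. Qed.
Lemma crossDr u v x : cross x (u + v) = cross x u + cross x v. Proof. vring. Qed.
Lemma crossDl u v x : cross (u + v) x = cross u x + cross v x. Proof. vring. Qed.
Lemma crossNr u x : cross x (- u) = - cross x u. Proof. vring. Qed.
Lemma crossNl u x : cross (- u) x = - cross u x. Proof. vring. Qed.
Lemma crossZr k u x : cross x (k *: u) = k *: cross x u. Proof. vring. Qed.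
Lemma crossZl k u x : cross (k *: u) x = k *: cross u x. Proof. vring. Qed.
Lemma cross0r x : cross x 0 = 0. Proof. vring. Qed.
Lemma crossxx x : cross x x = 0. Proof. vring. Qed.
Definition crosslE := (crossDr, crossDl, crossNr, crossNl, crossZr, crossZl, cross0r, crossxx).

Lemma dot_crossl u v : dot u (cross u v) = 0. Proof. vring. Qed.
Lemma dot_crossr u v : dot v (cross u v) = 0. Proof. vring. Qed.
Lemma cross_crossr u v x :
  cross u (cross v x) = dot u x *: v - dot u v *: x.
Proof. vring. Qed.
Lemma dotxx_ge0 x : 0 <= dot x x.
Proof. by rewrite dotE -!expr2 !addr_ge0 // sqr_ge0. Qed.

Lemma dotxx_eq0 x : (dot x x == 0) = (x == 0).
Proof.
apply/idP/eqP => [|->]; last by rewrite dot0l.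
rewrite dotE -!expr2 !paddr_eq0 ?addr_ge0 ?sqr_ge0 // !sqrf_eq0.
by move=> /andP[/andP[/eqP h0 /eqP h1] /eqP h2]; apply/vecP; rewrite zeroE.
Qed.

Lemma dotxx_gt0 x : (0 < dot x x) = (x != 0).
Proof. by rewrite lt0r dotxx_ge0 dotxx_eq0 andbT. Qed.

Lemma dot_ext x y : (forall z, dot z x <= dot z y) -> x = y.
Proof.
move=> h; apply/eqP; rewrite -subr_eq0 -dotxx_eq0 eq_le dotxx_ge0 andbT.
by rewrite dotBr subr_le0.
Qed.

Lemma cross_eq0_scale u x :
  u != 0 -> cross u x = 0 -> x = (dot u x / dot u u) *: u.
Proof.
rewrite -dotxx_eq0 => u0 h; have := cross_crossr u u x.
rewrite h cross0r => /esym/eqP; rewrite subr_eq0 => /eqP e.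
by rewrite mulrC -scalerA e scalerA mulVf // scale1r.
Qed.

Lemma cross_scale_eq0 k u : cross u (k *: u) = 0. Proof. vring. Qed.

Lemma cross_eq0P u x :
  u != 0 -> reflect (exists k, x = k *: u) (cross u x == 0).
Proof.
move=> u0; apply: (iffP eqP) => [h|[k ->]]; last exact: cross_scale_eq0.
by exists (dot u x / dot u u); exact: cross_eq0_scale.
Qed.

Lemma cross_eq0_trans u x y : u != 0 -> cross u x = 0 -> cross u y = 0 ->
  cross x y = 0.
Proof.
move=> u0 /cross_eq0_scale -> // /cross_eq0_scale -> //.
by rewrite !crosslE !scaler0.
Qed.

Lemma cross_sub_eq0 u x y z : cross u (x - z) = 0 -> cross u (y - z) = 0 ->
  cross u (x - y) = 0.
Proof.
move=> hx hy; rewrite (_ : x - y = (x - z) - (y - z)).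
  by rewrite crossDr crossNr hx hy subrr.
by rewrite opprB addrA subrK.
Qed.

Lemma perp_cross v x y : cross x y != 0 -> dot v x = 0 -> dot v y = 0 ->
  v = (dot (cross x y) v / dot (cross x y) (cross x y)) *: cross x y.
Proof.
move=> h hx hy; apply: cross_eq0_scale => //.
by rewrite crossC cross_crossr hx hy !scale0r subrr oppr0.
Qed.

Lemma perp_decomp u v x : u != 0 -> v != 0 -> dot u v = 0 -> dot u x = 0 ->
  x = (dot v x / dot v v) *: v +
      (dot (cross u v) x / dot (cross u v) (cross u v)) *: cross u v.
Proof.
move=> u0 v0 uv ux; have wE : dot (cross u v) (cross u v) = dot u u * dot v v.
  by transitivity (dot u u * dot v v - dot u v ^+ 2); [vring|rewrite uv; ring].
have u1 : dot u u != 0 by rewrite dotxx_eq0.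
have v1 : dot v v != 0 by rewrite dotxx_eq0.
have D : dot u u * dot v v != 0 by rewrite mulf_neq0.
apply: (scalerI D); rewrite wE scalerDr !scalerA.
rewrite (_ : _ * (_ / _) = dot u u * dot v x); last by field; rewrite ?u1 ?v1.
rewrite (_ : _ * (_ / _) = dot (cross u v) x); last by field; rewrite ?u1 ?v1.
(* Scaled by the squared norm of [cross u v], the expansion of any x in the frame u, v, [cross u v]
   is a polynomial identity; here the u-component vanishes. *)
have: dot (cross u v) (cross u v) *: x =
  (dot u x * dot v v - dot v x * dot u v) *: u +
  (dot v x * dot u u - dot u x * dot u v) *: v + dot (cross u v) x *: cross u v.
  vring.
rewrite wE uv ux !(mul0r, mulr0, subr0, scale0r, add0r, oppr0) => ->.
by rewrite [dot v x * _]mulrC.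
Qed.

Lemma cross_perp_neq0 u v : u != 0 -> v != 0 -> dot u v = 0 -> cross u v != 0.
Proof.
move=> u0 v0 uv; apply/negP => /cross_eq0P -/(_ u0)[k vE].
move: v0; rewrite -dotxx_eq0 {2}vE dotZr dotC uv mulr0.
by rewrite eqxx.
Qed.

Lemma perp_exists u : exists2 v, v != 0 & dot u v = 0.
Proof.
have [h|] := eqVneq (cross u (\row_i (i == 0)%:R)) 0; last first.
  by move=> h; exists (cross u (\row_i (i == 0)%:R)) => //; rewrite dot_crossl.
exists (\row_i (i == 1)%:R).
  by apply/eqP => /rowP/(_ 1)/eqP; rewrite !mxE oner_eq0.
move/rowP/(_ 2)/eqP: h; rewrite cross2E dotE !mxE /= mulr0 mulr1 sub0r.
by rewrite oppr_eq0 => /eqP ->; rewrite !mulr0 !addr0.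
Qed.

End Vectors.

(** * Properties that hold for all small positive e *)

Section SmallPositive.
Variable R : realType.
Implicit Types (p q e : R).

Definition ev (A : R -> Prop) : Prop :=
  exists e0 : R, 0 < e0 /\ forall e, 0 < e -> e < e0 -> A e.

Lemma ev_and (A B : R -> Prop) : ev A -> ev B -> ev (fun e => A e /\ B e).
Proof.
move=> [a [a0 hA]] [b [b0 hB]]; exists (Num.min a b).
rewrite lt_min a0 b0; split=> // e e0; rewrite lt_min => /andP[ea eb].
by split; [exact: hA|exact: hB].
Qed.

Lemma ev_imp (A B : R -> Prop) : ev A -> (forall e, 0 < e -> A e -> B e) -> ev B.
Proof. by move=> [a [a0 hA]] AB; exists a; split=> // e e0 ea; apply/AB/hA. Qed.

Lemma ev_ex (A : R -> Prop) : ev A -> exists2 e, 0 < e & A e.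
Proof. by move=> [a [a0 hA]]; exists (a / 2); [lra|apply: hA; lra]. Qed.

Lemma ev_all (T : eqType) (s : seq T) (A : T -> R -> Prop) :
  (forall a, a \in s -> ev (A a)) -> ev (fun e => forall a, a \in s -> A a e).
Proof.
elim: s => [|a s IH] h; first by exists 1; split.
have /IH{}IH : forall b, b \in s -> ev (A b).
  by move=> b bs; apply: h; rewrite inE bs orbT.
have ha := h a (mem_head _ _).
apply: (ev_imp (ev_and ha IH)) => e _ [hae hs] b.
by rewrite inE => /orP[/eqP ->|/hs].
Qed.

Lemma ev_lt0 p q : p < 0 -> ev (fun e => p + e * q < 0).
Proof.
move=> p0; have [q0|q0] := lerP q 0.
  by exists 1; split=> // e e0 _; rewrite ltr_wnDr // mulr_ge0_le0 // ltW.
exists (- p / q); split; first by rewrite divr_gt0 // oppr_gt0.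
by move=> e e0; rewrite ltr_pdivlMr // => h; lra.
Qed.

Lemma ev_neq0 p q : p != 0 \/ q != 0 -> ev (fun e => p + e * q != 0).
Proof.
have [-> []|p0 _] := eqVneq p 0; first by rewrite ?eqxx.
  move=> q0; exists 1; split=> // e e0 _.
  by rewrite add0r mulf_neq0 // gt_eqF.
wlog pn : p q p0 / p < 0.
  move=> wl; case/lt_total/orP: (p0) => pn; first exact: wl.
  apply: (ev_imp (wl (- p) (- q) _ _)); rewrite ?oppr_eq0 ?oppr_lt0 // => e _.
  by rewrite mulrN -opprD oppr_eq0.
by apply: (ev_imp (ev_lt0 q pn)) => e _ h; rewrite lt_eqF.
Qed.

End SmallPositive.

(** * Generators that maximise a linear form *)

Section ArgMax.
Variable R : realType.
Notation pt := 'rV[R]_3.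
Implicit Types (u v w x y z a b : pt) (s t : seq pt).

Definition amax s v : seq pt :=
  [seq a <- s | all (fun b => dot v b <= dot v a) s].

Lemma amaxP s v a :
  reflect (a \in s /\ forall b, b \in s -> dot v b <= dot v a) (a \in amax s v).
Proof. by rewrite mem_filter andbC; apply: (iffP andP) => -[as_ /allP h]. Qed.

Lemma amax_sub s v : {subset amax s v <= s}.
Proof. by move=> a /amaxP[]. Qed.

Lemma amax_eq s v a b : a \in amax s v -> b \in amax s v -> dot v a = dot v b.
Proof.
by move=> /amaxP[as_ ha] /amaxP[bs hb]; apply/eqP; rewrite eq_le ha ?hb.
Qed.

Lemma seq_argmax s (f : pt -> R) : s != [::] ->
  exists2 a, a \in s & forall b, b \in s -> f b <= f a.
Proof.
elim: s => // a s IH _; have [->|/IH[b bs hb]] := eqVneq s [::].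
  by exists a => [|b]; rewrite inE // => /eqP ->.
have [ab|ba] := lerP (f a) (f b).
  exists b => [|c]; rewrite inE ?bs ?orbT //.
  by move=> /orP[/eqP ->|/hb].
exists a => [|c]; rewrite inE ?eqxx // => /orP[/eqP ->|/hb h] //.
exact: le_trans h (ltW ba).
Qed.

Lemma amax_ex s v : s != [::] -> exists a, a \in amax s v.
Proof. by move=> /(seq_argmax (dot v))[a as_ h]; exists a; apply/amaxP. Qed.

Lemma eq_amax s v w :
  (forall a b, a \in s -> b \in s -> (dot v b <= dot v a) = (dot w b <= dot w a)) ->
  amax s v = amax s w.
Proof.
move=> h; apply: eq_in_filter => a as_; apply: eq_in_all => b bs; exact: h.
Qed.

Lemma amax_scale s v (k : R) : 0 < k -> amax s (k *: v) = amax s v.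
Proof. by move=> k0; apply: eq_amax => a b _ _; rewrite !dotZl ler_pM2l. Qed.

Lemma amax_const s v :
  (forall a b, a \in s -> b \in s -> dot v (a - b) = 0) -> amax s v = s.
Proof.
move=> h; apply/all_filterP/allP => a as_; apply/allP => b bs.
by rewrite -subr_le0 -dotBr h.
Qed.

(** Strict inequalities between the finitely many values of v survive a small perturbation, so x
    only breaks the ties of v. *)
Lemma amax_lex s v x : ev (fun e => amax s (v + e *: x) = amax (amax s v) x).
Proof.
have: ev (fun e => forall a, a \in s -> forall b, b \in s ->
   dot v b < dot v a -> dot (v + e *: x) b < dot (v + e *: x) a).
  apply: ev_all => a as_; apply: ev_all => b bs.
  have [vab|_] := ltrP (dot v b) (dot v a); last by exists 1; split.
  have /ev_lt0 h : dot v b - dot v a < 0 by rewrite subr_lt0.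
  apply: (ev_imp (h (dot x b - dot x a))) => e _ {}h _.
  by rewrite !dotlE; lra.
move=> h; apply: (ev_imp h) => e e0 {}h.
rewrite /amax -filter_predI; apply: eq_in_filter => a as_ /=.
apply/idP/andP => [/allP le|[/allP lex /allP lev]].
  have lev b : b \in s -> dot v b <= dot v a.
    move=> bs; rewrite leNgt; apply/negP => /(h _ bs _ as_).
    by rewrite ltNge le.
  split; apply/allP; last exact: lev.
  move=> b /amaxP[bs hb]; have := le _ bs; rewrite !dotlE.
  have -> : dot v b = dot v a by apply/eqP; rewrite eq_le lev // hb.
  by rewrite lerD2l ler_pM2l.
apply/allP => b bs; have := lev _ bs; rewrite le_eqVlt => /orP[/eqP vE|].
  have : b \in amax s v by apply/amaxP; split=> // c cs; rewrite vE; exact: lev.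
  by move=> /lex; rewrite !dotlE vE lerD2l ler_pM2l.
by move=> /(h _ as_ _ bs) /ltW.
Qed.

End ArgMax.

(** * Convex hulls of finite lists *)

Section Conv.
Variable R : realType.
Notation pt := 'rV[R]_3.
Implicit Types (u v w x y z a b : pt) (s t : seq pt).

Definition convex (C : pset R) : Prop := forall x y (k : R),
  0 < k -> k < 1 -> C x -> C y -> C (k *: x + (1 - k) *: y).

Lemma conv_mem s a : a \in s -> conv s a.
Proof.
move=> as_; have i := index_mem a s; rewrite as_ in i.
exists (fun j => (j == Ordinal i)%:R); split; first by move=> j; rewrite ler0n.
split.
  rewrite (bigD1 (Ordinal i)) //= eqxx big1 ?addr0 // => j /negbTE ->.
  by [].
rewrite (bigD1 (Ordinal i)) //= eqxx scale1r nth_index // big1 ?addr0 //.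
by move=> j /negbTE ->; rewrite scale0r.
Qed.

Lemma conv_convex s : convex (conv s).
Proof.
move=> x y k k0 k1 [w [w0 [w1 ->]]] [w' [w'0 [w'1 ->]]].
exists (fun i => k * w i + (1 - k) * w' i); split.
  by move=> i; rewrite addr_ge0 // mulr_ge0 // ?w0 ?w'0 // ?subr_ge0 ltW.
split; first by rewrite big_split /= -!mulr_sumr w1 w'1; ring.
rewrite !scaler_sumr -big_split /=; apply: eq_bigr => i _.
by rewrite [RHS]scalerDl !scalerA.
Qed.

(** Normalising the weights only in the conclusion lets the induction drop the last term without
    rescaling the others. *)
Lemma convex_sum (C : pset R) n (w : 'I_n -> R) (a : 'I_n -> pt) :
  convex C -> (forall i, 0 <= w i) -> (forall i, C (a i)) ->
  0 < \sum_i w i -> C ((\sum_i w i)^-1 *: \sum_i w i *: a i).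
Proof.
move=> cC; elim: n w a => [|n IH] w a w0 aC; first by rewrite big_ord0 ltxx.
rewrite !big_ord_recr /=; set W := \sum_(i < n) _; set X := \sum_(i < n) _.
set wn := w _; set an := a _ => hW.
have W0 : 0 <= W by apply: sumr_ge0.
have wn0 : 0 <= wn by apply: w0.
have [WE|Wp] := eqVneq W 0.
  have XE : X = 0.
    rewrite /X big1 // => i _; have /psumr_eq0P/(_ i) -> // : \sum_(i < n)
      w (widen_ord (leqnSn n) i) = 0 by [].
    by rewrite scale0r.
  move: hW; rewrite WE XE !add0r => hW.
  by rewrite scalerA mulVf ?gt_eqF // scale1r; exact: aC.
have {W0 Wp} W0 : 0 < W by rewrite lt0r Wp.
have CX : C (W^-1 *: X) by apply: IH.
have [wE|wp] := eqVneq wn 0; first by rewrite wE scale0r !addr0.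
have {wn0 wp} wn0 : 0 < wn by rewrite lt0r wp.
have -> : (W + wn)^-1 *: (X + wn *: an) =
    (W / (W + wn)) *: (W^-1 *: X) + (1 - W / (W + wn)) *: an.
  rewrite scalerDr !scalerA; congr (_ *: _ + _ *: _); field.
    by rewrite !gt_eqF.
  by rewrite gt_eqF.
apply: cC => //; last exact: aC; first by rewrite divr_gt0.
by rewrite ltr_pdivrMr // mul1r ltrDl.
Qed.

Lemma conv_sub s (C : pset R) : convex C -> (forall a, a \in s -> C a) ->
  forall x, conv s x -> C x.
Proof.
move=> cC sC x [w [w0 [w1 ->]]].
have := @convex_sum C _ w (fun i : 'I_(size s) => s`_i) cC w0.
by rewrite w1 invr1 scale1r; apply=> // i; apply/sC/mem_nth.
Qed.

(* A point of the convex hull that maximises v is a convex combination of the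
   generators that maximise v; this is the dual form of that fact. *)
Lemma conv_argmax s v y x (M k : R) : conv s x ->
  (forall a, a \in s -> dot v a <= M) ->
  (forall a, a \in s -> dot v a = M -> dot y a <= k) ->
  dot v x <= M /\ (dot v x = M -> dot y x <= k).
Proof.
move=> sx hM hk.
pose C z := dot v z <= M /\ (dot v z = M -> dot y z <= k).
apply: (@conv_sub s C _ _ x sx) => [|a as_]; last first.
  by split; [exact: hM|exact: hk].
move=> p q l l0 l1 [pM pk] [qM qk]; rewrite /C !dotlE.
have H (m c d e : R) : m = 1 - l -> c <= e -> d <= e -> l * c + m * d <= e.
  move=> ->; nra.
split; first exact: H.
move=> E; apply: H => //.
  by apply: pk; nra.
by apply: qk; nra.
Qed.

Lemma conv_le s v x (M : R) : conv s x ->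
  (forall a, a \in s -> dot v a <= M) -> dot v x <= M.
Proof.
move=> sx h; have /(_ 0 0)[] // := @conv_argmax s v _ x M _ sx h.
by move=> *; rewrite dot0l.
Qed.

End Conv.

(** * Affine dimension through cross and triple products *)

Section Dimension.
Variable R : realType.
Notation pt := 'rV[R]_3.
Implicit Types (u v w x y z a b : pt) (S T : pset R).

Lemma dim_ge_sub S T k : (forall x, S x -> T x) -> dim_ge S k -> dim_ge T k.
Proof. by move=> ST [p [pS pf]]; exists p; split=> // i; apply/ST. Qed.

Lemma row_freeN0 k (A : 'M[R]_(k, 3)) :
  (forall c : 'rV_k, \sum_i c 0 i *: row i A = 0 -> c = 0) -> row_free A.
Proof.
move=> h; rewrite -kermx_eq0; apply/eqP/row_matrixP => i; rewrite row0.
by apply: h; rewrite -mulmx_sum_row -row_mul mulmx_ker row0.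
Qed.

Lemma dim_ge1I S a b : S a -> S b -> a != b -> dim_ge S 1.
Proof.
move=> Sa Sb ab; exists (fun i : 'I_2 => [:: a; b]`_i); split.
  by case=> -[|[|]].
apply: row_freeN0 => c; rewrite big_ord1 rowK /= => /eqP.
rewrite scaler_eq0 subr_eq0 [b == a]eq_sym (negbTE ab) orbF => /eqP c0.
by apply/rowP => i; rewrite ord1 c0 mxE.
Qed.

Lemma dim_ge2I S a b x : S a -> S b -> S x -> cross (b - a) (x - a) != 0 ->
  dim_ge S 2.
Proof.
move=> Sa Sb Sx ab; exists (fun i : 'I_3 => [:: a; b; x]`_i); split.
  by case=> -[|[|[|]]].
apply: row_freeN0 => c; rewrite !big_ord_recl big_ord0 !rowK /= addr0 => E.
have E1 := congr1 (cross (b - a)) E; have E2 := congr1 (cross (x - a)) E.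
apply/rowP => -[[|[|//]] hi]; rewrite mxE.
  move/eqP: E2; rewrite crossDr !crossZr crossxx cross0r scaler0 addr0.
  rewrite scaler_eq0 crossC oppr_eq0 (negbTE ab) orbF => /eqP <-.
  by congr (c _ _); apply/val_inj.
move/eqP: E1; rewrite crossDr !crossZr crossxx cross0r scaler0 add0r.
rewrite scaler_eq0 (negbTE ab) orbF => /eqP <-.
by congr (c _ _); apply/val_inj.
Qed.

Lemma dim_ge2P S : dim_ge S 2 ->
  exists a b x, [/\ S a, S b, S x & cross (b - a) (x - a) != 0].
Proof.
move=> [p [pS pf]]; exists (p 0), (p (lift ord0 0)), (p (lift ord0 1)).
split=> //; apply/negP => /eqP h; set A := (\matrix_i _) in pf.
have key (c : 'rV_2) : c *m A = 0 -> c = 0.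
  by move=> cA; apply: (row_free_inj pf); rewrite cA mul0mx.
(* With a zero cross product the rows satisfy an explicit relation: (1, 0) if the first row
   vanishes, (k, -1) otherwise. *)
have [E|x0] := eqVneq (p (lift ord0 0) - p 0) 0.
  have /key : (delta_mx 0 0 : 'rV_2) *m A = 0 by rewrite -rowE rowK.
  by move=> /rowP/(_ 0)/eqP; rewrite !mxE !eqxx oner_eq0.
have E := cross_eq0_scale x0 h; move: E; set k := _ / _ => E.
have /key : (k *: delta_mx 0 0 - delta_mx 0 1 : 'rV_2) *m A = 0.
  by rewrite mulmxBl -scalemxAl -!rowE !rowK E subrr.
move=> /rowP/(_ 1)/eqP; rewrite !mxE /= mulr0 sub0r oppr_eq0.
by rewrite oner_eq0.
Qed.

Lemma dim_ge3I S a b x y : S a -> S b -> S x -> S y ->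
  dot (cross (b - a) (x - a)) (y - a) != 0 -> dim_ge S 3.
Proof.
move=> Sa Sb Sx Sy h; exists (fun i : 'I_4 => [:: a; b; x; y]`_i); split.
  by case=> -[|[|[|[|]]]].
apply: row_freeN0 => c; rewrite !big_ord_recl big_ord0 !rowK /= addr0.
move: h; move: (b - a) (x - a) (y - a) => {Sa Sb Sx Sy}p q r h E.
(* Cramer's rule: pairing the relation with each pairwise cross product leaves one coefficient times
   the triple product. *)
have E1 := congr1 (dot (cross q r)) E; have E2 := congr1 (dot (cross r p)) E.
have E3 := congr1 (dot (cross p q)) E.
have hq : dot (cross q r) p = dot (cross p q) r by rewrite !coordE; ring.
have hr : dot (cross r p) q = dot (cross p q) r by rewrite !coordE; ring.
have pC v w : dot (cross v w) v = 0 by rewrite dotC dot_crossl.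
have qC v w : dot (cross v w) w = 0 by rewrite dotC dot_crossr.
apply/rowP => -[[|[|[|//]]] hi]; rewrite mxE.
- move/eqP: E1; rewrite !dotlE hq pC qC !mulr0 !addr0.
  rewrite mulf_eq0 (negbTE h) orbF => /eqP <-.
  by congr (c _ _); apply/val_inj.
- move/eqP: E2; rewrite !dotlE hr pC qC !mulr0 !addr0 !add0r.
  rewrite mulf_eq0 (negbTE h) orbF => /eqP <-.
  by congr (c _ _); apply/val_inj.
- move/eqP: E3; rewrite !dotlE pC qC !mulr0 !add0r.
  rewrite mulf_eq0 (negbTE h) orbF => /eqP <-.
  by congr (c _ _); apply/val_inj.
Qed.

Lemma dim_ge3N S w (k : R) : w != 0 -> (forall x, S x -> dot w x = k) ->
  ~ dim_ge S 3.
Proof.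
move=> w0 h [p [pS pf]]; set A := (\matrix_i _) in pf.
have Aw : A *m w^T = 0.
  apply/matrixP => i j; rewrite ord1 !mxE.
  transitivity (dot w (p (lift ord0 i) - p ord0)).
    by apply: eq_bigr => l _; rewrite !mxE mulrC.
  by rewrite dotBr !h // subrr.
have Au : A \in unitmx by rewrite -row_free_unit.
move/(congr1 (mulmx (invmx A))): Aw; rewrite mulKmx // mulmx0.
by move/(congr1 trmx); rewrite trmxK trmx0; apply/eqP.
Qed.

(** Lets polygons and segments be treated together. Affinely independent generators a, b, x are
    picked greedily and a normal to their span is taken; once there are three, a generator off their
    plane would contradict either bound. *)
Lemma flat_normal S (s : seq pt) : s != [::] -> (forall a, a \in s -> S a) ->
  (~ dim_ge S 2 \/ ~ dim_ge S 3) ->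
  exists2 w, w != 0 & forall a b, a \in s -> b \in s -> dot w (a - b) = 0.
Proof.
case: s => // a s _; set r := a :: s => rS hS; have ar : a \in r by rewrite mem_head.
suff [w w0 h] : exists2 w, w != 0 & forall b, b \in r -> dot w (b - a) = 0.
  exists w => // b x br xr; rewrite (_ : b - x = (b - a) - (x - a)).
    by rewrite dotBr !h // subrr.
  by rewrite opprB addrA subrK.
have [/hasP[b br ba]|/hasPn h] := boolP (has (fun b => b - a != 0) r); last first.
  have [w w0 _] := perp_exists (0 : pt); exists w => // b /h.
  by rewrite negbK => /eqP ->; rewrite dot0r.
have [/hasP[x xr bx]|/hasPn h] := boolP (has (fun x => cross (b - a) (x - a) != 0) r).
  exists (cross (b - a) (x - a)) => // y yr; apply/eqP/negPn/negP => h.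
  case: hS; apply; last exact: dim_ge3I (rS _ ar) (rS _ br) (rS _ xr) (rS _ yr) h.
  exact: dim_ge2I (rS _ ar) (rS _ br) (rS _ xr) bx.
have [w w0 uw] := perp_exists (b - a); exists w => // x /h; rewrite negbK => /eqP.
by move=> /cross_eq0_scale ->; rewrite // dotZr [dot w _]dotC uw mulr0.
Qed.

End Dimension.

(** * Faces, normal cones and aggregated cones in terms of generators *)

Section Faces.
Variable R : realType.
Notation pt := 'rV[R]_3.
Implicit Types (u v w x y z a b : pt) (s t d : seq pt) (P Q F : pset R).

Definition pface P v : pset R := fun x => P x /\ forall y, P y -> dot v y <= dot v x.

Lemma face_pface P v : face P (pface P v).
Proof. by exists v. Qed.

Lemma pface_amax P s v a : seteq P (conv s) -> a \in amax s v -> pface P v a.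
Proof.
move=> hP /amaxP[as_ h]; split; first exact/hP/conv_mem.
by move=> y /hP sy; exact: conv_le sy h.
Qed.

Lemma pface_le P s v y x (k : R) : seteq P (conv s) -> s != [::] -> pface P v x ->
  (forall a, a \in amax s v -> dot y a <= k) -> dot y x <= k.
Proof.
move=> hP s0 [/hP sx hx] h; have [a aM] := amax_ex v s0.
have [as_ ha] := amaxP _ _ _ aM.
have /(_ y k)[] // := @conv_argmax R s v _ x (dot v a) _ sx ha.
  move=> b bs vE; apply/h/amaxP; split=> // c cs; rewrite vE; exact: ha.
move=> le; apply; apply/eqP; rewrite eq_le le hx //; exact/hP/conv_mem.
Qed.

(** Since z.(u x y) = (z x u).y, parallelism to u is a family of linear conditions, which [pface_le]
    carries from the generators to the face. *)
Lemma pface_par P s u v x a : seteq P (conv s) -> a \in amax s v -> pface P v x ->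
  (forall b, b \in amax s v -> cross u (b - a) = 0) -> cross u (x - a) = 0.
Proof.
move=> hP aM fx h; apply: dot_ext => z; rewrite dot0r.
have E y : dot z (cross u y) = dot (cross z u) y by rewrite !coordE; ring.
have s0 : s != [::] by move: aM; case: (s).
rewrite E dotBr subr_le0; apply: (pface_le hP s0 fx) => b /h/(congr1 (dot z)).
by rewrite E dotBr dot0r => /eqP; rewrite subr_eq0 => /eqP ->.
Qed.

Definition ncone s w : pset R := fun v => {subset amax s w <= amax s v}.

Lemma normal_coneP P s F w v : seteq P (conv s) -> s != [::] ->
  seteq F (pface P w) -> normal_cone P F v <-> ncone s w v.
Proof.
move=> hP s0 hF; split=> [h a aw|h x y Px /hF Fy].
  apply/amaxP; split=> [|b bs]; first exact: amax_sub aw.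
  by apply: h; [exact/hP/conv_mem|apply/hF/(pface_amax hP)].
have [a aw] := amax_ex w s0; have /amaxP[as_ av] := h _ aw.
apply: (@le_trans _ _ (dot v a)); first by apply: conv_le av; exact/hP.
(* Applied to -v, [pface_le] gives the lower bound for v on the face. *)
rewrite -[leRHS]opprK -dotNl lerNr; apply: (pface_le hP s0 Fy) => b /h bv.
by rewrite dotNl (amax_eq bv (h _ aw)).
Qed.

Lemma agg_coneP P s u v : seteq P (conv s) -> s != [::] -> agg_cone P u v <->
  exists w, [/\ pdim (ncone s w) 2, (forall x, ncone s w x -> dot u x = 0) &
               ncone s w v].
Proof.
move=> hP s0; split=> [[F [[w hF] [[d2 d3] [h Fv]]]]|[w [[d2 d3] h wv]]].
  have E x := normal_coneP x hP s0 hF.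
  exists w; split; [split|by move=> x /E /h|exact/E].
    by apply: dim_ge_sub d2 => x /E.
  by move=> d3'; apply: d3; apply: dim_ge_sub d3' => x /E.
have E x := @normal_coneP P s (pface P w) w x hP s0 (fun=> conj id id).
exists (pface P w); split; first exact: face_pface.
split; [split|split; [by move=> x /E /h|exact/E]].
  by apply: dim_ge_sub d2 => x /E.
by move=> d3'; apply: d3; apply: dim_ge_sub d3' => x /E.
Qed.

(* When v is generic in the plane orthogonal to u, this is membership of v in the
   aggregated cone of conv s at u. *)
Definition hit s u v : bool :=
  has (fun a => has (fun b => (a != b) && (cross u (a - b) == 0)) (amax s v)) (amax s v).

Lemma hitP s u v :
  reflect (exists a b, [/\ a \in amax s v, b \in amax s v, a != b & cross u (a - b) = 0])
    (hit s u v).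
Proof.
apply: (iffP hasP) => [[a aM /hasP[b bM /andP[ab /eqP h]]]|[a [b [aM bM ab h]]]].
  by exists a, b.
by exists a => //; apply/hasP; exists b => //; rewrite ab h /=.
Qed.

(* With the differences of the generators listed in d, a generic v exposes a vertex
   or an edge parallel to u. *)
Definition gen d u v : Prop :=
  [/\ v != 0, dot u v = 0 & forall x, x \in d -> cross u x != 0 -> dot v x != 0].

(** One list d can cover the generators of P, Q and P + Q at once, so that all three are tested on
    the same generic vectors. *)
Definition covers d s : Prop := forall a b, a \in s -> b \in s -> a - b \in d.

Lemma gen_opp d u v : gen d u v -> gen d u (- v).
Proof.
move=> [v0 uv h]; split; rewrite ?oppr_eq0 ?dotNr ?uv ?oppr0 // => x xd ux.
by rewrite dotNl oppr_eq0 h.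
Qed.

Lemma gen_amax d s u v a b : covers d s -> gen d u v -> a \in amax s v ->
  b \in amax s v -> cross u (a - b) = 0.
Proof.
move=> ds [_ _ h] aM bM; apply/eqP/negPn/negP => ux.
have := h _ (ds a b (amax_sub aM) (amax_sub bM)) ux.
by rewrite dotBr (amax_eq aM bM) subrr eqxx.
Qed.

Lemma ev_gen d u v g : dot u v = 0 -> gen d u g -> ev (fun e => gen d u (v + e *: g)).
Proof.
move=> uv [g0 ug h].
have g1 : ev (fun e => dot g v + e * dot g g != 0).
  by apply: ev_neq0; right; rewrite dotxx_eq0.
have : ev (fun e => forall x, x \in d -> cross u x != 0 -> dot v x + e * dot g x != 0).
  apply: ev_all => x xd; have [ux|] := boolP (cross u x != 0); last by exists 1; split.
  have /ev_neq0 hx : dot v x != 0 \/ dot g x != 0 by right; exact: h.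
  by apply: (ev_imp hx).
move=> /(ev_and g1){}h; apply: (ev_imp h) => e e0 [ge xe]; split.
- by apply: contraNneq ge => E; rewrite -dotZr -dotDr E dot0r.
- by rewrite dotDr dotZr uv ug mulr0 addr0.
- by move=> x xd ux; rewrite dotDl dotZl xe.
Qed.

(** A difference x orthogonal to both p and q would be a multiple of [cross p q], as is u, hence
    parallel to u. For any other x, the affine function of e is not identically zero. *)
Lemma ev_gen_pair d u p q : dot u p = 0 -> dot u q = 0 -> cross p q != 0 ->
  ev (fun e => gen d u (p + e *: q)).
Proof.
move=> up uq pq.
have q0 : q != 0 by apply: contraNneq pq => ->; rewrite cross0r.
have g1 : ev (fun e => dot q p + e * dot q q != 0).
  by apply: ev_neq0; right; rewrite dotxx_eq0.
have : ev (fun e => forall x, x \in d -> cross u x != 0 -> dot p x + e * dot q x != 0).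
  apply: ev_all => x xd; have [ux|] := boolP (cross u x != 0); last by exists 1; split.
  suff /ev_neq0 h : dot p x != 0 \/ dot q x != 0 by apply: (ev_imp h).
  apply/orP; rewrite -negb_and; apply: contraNN ux => /andP[/eqP px /eqP qx].
  rewrite (perp_cross pq up uq) (@perp_cross _ x p q pq) 1?dotC //.
  by rewrite !crosslE !scaler0.
move=> /(ev_and g1)h; apply: (ev_imp h) => e e0 [ge xe]; split.
- by apply: contraNneq ge => E; rewrite -dotZr -dotDr E dot0r.
- by rewrite dotDr dotZr up uq mulr0 addr0.
- by move=> x xd ux; rewrite dotDl dotZl xe.
Qed.

Lemma gen_ex d u : u != 0 -> exists g, gen d u g.
Proof.
move=> u0; have [v v0 uv] := perp_exists u.
have h := cross_perp_neq0 u0 v0 uv.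
have := @ev_gen_pair d u v (cross u v) uv (dot_crossl _ _) _.
rewrite cross_crossr dotC uv scale0r subr0 scaler_eq0 dotxx_eq0 (negbTE v0) (negbTE u0).
by move=> /(_ isT)/ev_ex[e _ g]; exists (v + e *: cross u v).
Qed.

Lemma amax_perp d s u g x : covers d s -> gen d u g -> u != 0 -> dot u x = 0 ->
  amax (amax s g) x = amax s g.
Proof.
move=> ds gg u0 ux; apply: amax_const => a b aM bM.
rewrite (cross_eq0_scale u0 (gen_amax ds gg aM bM)) dotZr [dot x u]dotC ux.
by rewrite mulr0.
Qed.

(** Two exposed points that differ by a multiple of u force the cone into the plane orthogonal to u.
    Turning the generic g slightly inside this plane keeps the face, which gives the second
    dimension. *)
Lemma hit_ncone d s u g : covers d s -> u != 0 -> gen d u g -> hit s u g ->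
  pdim (ncone s g) 2 /\ forall x, ncone s g x -> dot u x = 0.
Proof.
move=> ds u0 gg /hitP[a [b [aM bM ab /eqP/(cross_eq0P _ u0)[k E]]]].
have k0 : k != 0 by apply: contraNneq ab => k0; rewrite -subr_eq0 E k0 scale0r.
have sub x : ncone s g x -> dot u x = 0.
  move=> gx; have := amax_eq (gx _ aM) (gx _ bM) => /eqP.
  by rewrite -subr_eq0 -dotBr E dotZr mulf_eq0 (negbTE k0) dotC => /eqP.
split=> //; split; last exact: (@dim_ge3N _ _ u 0).
have [g0 ug _] := gg.
have /ev_ex[e e0 h] := amax_lex s g (cross u g).
rewrite (amax_perp ds gg u0 (dot_crossl _ _)) in h.
apply: (@dim_ge2I _ _ 0 g (g + e *: cross u g)).
- move=> c cM; apply/amaxP; split=> [|y _]; first exact: amax_sub cM.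
  by rewrite !dot0l.
- by move=> c.
- by rewrite /ncone h => c.
rewrite !subr0 crossDr crossxx add0r crossZr cross_crossr [dot g u]dotC ug.
rewrite scale0r subr0 scalerA scaler_eq0 mulf_eq0 dotxx_eq0.
by rewrite (negbTE g0) (negbTE u0) gt_eqF.
Qed.

Lemma agg_cone_perp P u v : agg_cone P u v -> dot u v = 0.
Proof. by move=> [F [_ [_ [h /h]]]]. Qed.

Lemma agg_cone_gen P s d u g : seteq P (conv s) -> s != [::] -> covers d s ->
  u != 0 -> gen d u g -> agg_cone P u g <-> hit s u g.
Proof.
move=> hP s0 ds u0 gg; split=> [|hg]; last first.
  apply/(agg_coneP _ _ hP s0); exists g.
  by have [? ?] := hit_ncone ds u0 gg hg; split=> // a.
move=> /(agg_coneP _ _ hP s0)[w [_ wu wg]]; apply/negPn/negP => /hitP nh.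
have [a aw] := amax_ex w s0; have ag := wg _ aw.
have single b : b \in amax s g -> b = a.
  move=> bg; apply/eqP/negPn/negP => ba; apply: nh; exists b, a.
  by split=> //; exact: gen_amax ds gg bg ag.
(* Without a hit, g exposes a single point, so g tilted towards u is still in the normal cone,
   although it is not orthogonal to u. *)
have /ev_ex[e e0 h] := amax_lex s g u.
have /wu : ncone s w (g + e *: u).
  move=> b /wg /single ->; rewrite h; apply/amaxP; split=> // c /single ->.
  by [].
have [_ ug _] := gg; rewrite dotDr dotZr ug add0r => /eqP.
by rewrite mulf_eq0 gt_eqF //= dotxx_eq0 (negbTE u0).
Qed.

(** v lies in one of the two-dimensional convex cones of the union, and a generic g of that same
    cone may be added with any positive weight. *)
Lemma agg_cone_dense P s d u v : seteq P (conv s) -> s != [::] ->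
  agg_cone P u v ->
  exists2 g, gen d u g & forall e : R, 0 < e -> agg_cone P u (v + e *: g).
Proof.
move=> hP s0 /(agg_coneP _ _ hP s0)[w [[d2 d3] wu wv]].
have add x y (e : R) : 0 < e -> ncone s w x -> ncone s w y -> ncone s w (x + e *: y).
  move=> e0 hx hy a aw; have /amaxP[as_ ax] := hx _ aw; have /amaxP[_ ay] := hy _ aw.
  apply/amaxP; split=> // b bs; rewrite !dotlE lerD ?ax // ler_pM2l //.
  exact: ay.
suff [g gg wg] : exists2 g, gen d u g & ncone s w g.
  exists g => // e e0; apply/(agg_coneP _ _ hP s0); exists w.
  by split=> //; exact: add.
(* Of three vectors that are not collinear as points, two are linearly independent. *)
have [p [q [wp wq pq]]] : exists p q, [/\ ncone s w p, ncone s w q & cross p q != 0].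
  have [a [b [c [wa wb wc]]]] := dim_ge2P d2.
  have [ab|] := eqVneq (cross a b) 0; last by exists a, b.
  have [bc|] := eqVneq (cross b c) 0; last by exists b, c.
  have [ca|] := eqVneq (cross c a) 0; last by exists c, a.
  have -> : cross (b - a) (c - a) = cross a b + cross b c + cross c a.
    by apply/vecP; rewrite !coordE; ring.
  by rewrite ab bc ca !addr0 eqxx.
have /ev_ex[e e0 gg] := ev_gen_pair d (wu _ wp) (wu _ wq) pq.
by exists (p + e *: q) => //; exact: add.
Qed.

(** For small e, the generators exposed by v + e g are among those exposed by v, so v is in the
    closed normal cone of that smaller face. *)
Lemma agg_cone_closed P s d u v g : seteq P (conv s) -> s != [::] -> covers d s ->
  u != 0 -> ev (fun e => gen d u (v + e *: g) /\ hit s u (v + e *: g)) ->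
  agg_cone P u v.
Proof.
move=> hP s0 ds u0 /(ev_and (amax_lex s v g))/ev_ex[e e0 [E [gg hg]]].
apply/(agg_coneP _ _ hP s0); exists (v + e *: g).
have [? ?] := hit_ncone ds u0 gg hg; split=> // a; rewrite E.
exact: amax_sub.
Qed.

(** Density and closedness reduce inclusion to generic vectors. The sign k serves both equal and
    opposite cones. *)
Lemma agg_cone_sub P Q s t d u (k : R) : seteq P (conv s) -> s != [::] -> covers d s ->
  seteq Q (conv t) -> t != [::] -> covers d t -> u != 0 -> k = 1 \/ k = -1 ->
  (forall g, gen d u g -> hit s u g -> hit t u (k *: g)) ->
  forall v, agg_cone P u v -> agg_cone Q u (k *: v).
Proof.
move=> hP s0 ds hQ t0 dt u0 k1 h v Pv.
have [g gg hg] := agg_cone_dense d hP s0 Pv.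
apply: (@agg_cone_closed _ t d _ _ (k *: g)) => //.
apply: (ev_imp (ev_gen (agg_cone_perp Pv) gg)) => e e0 ge.
rewrite scalerA [e * k]mulrC -scalerA -scalerDr; split.
  by case: k1 => ->; rewrite ?scale1r ?scaleN1r //; exact: gen_opp.
by apply: h => //; apply/(agg_cone_gen hP s0 ds u0 ge)/hg.
Qed.

Lemma agg_cone_full P s d u : seteq P (conv s) -> s != [::] -> covers d s -> u != 0 ->
  seteq (agg_cone P u) (orth_plane u) <-> forall g, gen d u g -> hit s u g.
Proof.
move=> hP s0 ds u0; split=> [h g gg|h v].
  by apply/(agg_cone_gen hP s0 ds u0 gg)/h; case: gg.
split=> [/agg_cone_perp //|uv]; have [g gg] := gen_ex d u0.
apply: (@agg_cone_closed _ s d _ _ g) => //.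
by apply: (ev_imp (ev_gen uv gg)) => e e0 ge; split=> //; exact: h.
Qed.

Lemma edge_direction_hit P s d u : seteq P (conv s) -> s != [::] -> covers d s ->
  dot u u = 1 -> first_nonzero_pos u ->
  edge_direction P u <-> exists2 g, gen d u g & hit s u g.
Proof.
move=> hP s0 ds u1 up; have u0 : u != 0 by rewrite -dotxx_eq0 u1 oner_eq0.
split=> [[_ [_ [E [a [b [l [[[w hE] [d1 d2]] [Ea [Eb [_ [_ [ab baE]]]]]]]]]]]]|].
  have ba0 : b - a != 0 by rewrite subr_eq0; apply/eqP => /esym.
  have l0 : l != 0 by apply: contraNneq ba0 => l0; rewrite baE l0 scale0r.
  have par x : E x -> cross u (x - a) = 0.
    move=> Ex; apply/eqP/negPn/negP => h; apply: d2; apply: (dim_ge2I Ea Eb Ex).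
    by rewrite baE crossZl scaler_eq0 negb_or l0.
  have parM x y : x \in amax s w -> y \in amax s w -> cross u (x - y) = 0.
    move=> /(pface_amax hP)/hE/par hx /(pface_amax hP)/hE/par hy.
    exact: cross_sub_eq0 hx hy.
  have uw : dot u w = 0.
    have /hE[Pa ha] := Ea; have /hE[Pb hb] := Eb.
    have : dot w (b - a) = 0.
      by apply/eqP; rewrite dotBr subr_eq0 eq_le ha // hb.
    by rewrite baE dotZr dotC => /eqP; rewrite mulf_eq0 (negbTE l0) => /eqP.
  (* The normal w of the edge need not be generic. Moving it inside the plane orthogonal to u
     exposes the same generators, since these differ by multiples of u. *)
  have [z gz] := gen_ex d u0; have [_ uz _] := gz.
  have /ev_ex[e e0 [ge hx]] := ev_and (ev_gen uw gz) (amax_lex s w z).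
  exists (w + e *: z) => //; have hM : amax s (w + e *: z) = amax s w.
    rewrite hx; apply: amax_const => x y /parM h /h /cross_eq0_scale ->//.
    by rewrite dotZr [dot z u]dotC uz mulr0.
  apply/negPn/negP => nh; have [c cM] := amax_ex w s0.
  (* If all exposed generators coincided, the edge would be one point. *)
  have single x : E x -> x = c.
    move=> /hE fx; apply: dot_ext => y; apply: (pface_le hP s0 fx) => x' x'M.
    rewrite le_eqVlt; apply/orP; left; apply/eqP; congr dot.
    apply/eqP/negPn/negP => x'c; move/hitP: nh; apply; exists x', c.
    by rewrite hM; split=> //; exact: parM.
  by case: ab; rewrite (single a) // (single b).
move=> [g gg hg]; split=> //; split=> //.
have [x1 [x2 [x1M x2M x12 _]]] := hitP _ _ _ hg.
have gn0 : amax s g != [::] by move: x1M; case: (amax s g).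
have ug : dot u g = 0 by case: gg.
(* Tilting g by a small multiple of u, of either sign, exposes one endpoint of the segment alone. *)
have vtx (k : R) a : k != 0 -> a \in amax (amax s g) (k *: u) -> vertex P a.
  move=> k0 aM; have /amaxP[aM' amx] := aM; split.
    exact/hP/conv_mem/(amax_sub aM').
  have /ev_ex[e e0 E] := amax_lex s g (k *: u).
  exists (g + e *: (k *: u)) => y Py ya.
  have afa : a \in amax s (g + e *: (k *: u)) by rewrite E.
  have [_ /(_ y Py)] := pface_amax hP afa.
  rewrite le_eqVlt => /orP[/eqP yE|//]; case: ya; apply: dot_ext => z.
  apply: (pface_le hP s0 (v := g + e *: (k *: u))).
    split=> // x Px; rewrite yE; have [_] := pface_amax hP afa.
    exact.
  move=> b; rewrite E => bM; rewrite le_eqVlt; apply/orP; left; apply/eqP; congr dot.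
  have /amaxP[bM' _] := bM.
  have := cross_eq0_scale u0 (gen_amax ds gg bM' aM').
  have := amax_eq bM aM; rewrite !dotZl => /(mulfI k0)/eqP.
  by rewrite -subr_eq0 -dotBr => /eqP ->; rewrite mul0r scale0r => /subr0_eq.
have [a aM] := amax_ex (1 *: u) gn0; have [b bM] := amax_ex (- 1 *: u) gn0.
have aM' := amax_sub aM; have bM' := amax_sub bM.
have ab : a != b.
  apply/negP => /eqP abE; rewrite -abE in bM bM' *.
  move/amaxP: aM => [_ aM]; move/amaxP: bM => [_ bM].
  have uc x : x \in amax s g -> dot u x = dot u a.
    move=> xM; move: (aM _ xM) (bM _ xM); rewrite !dotZl; lra.
  move: x12; rewrite -subr_eq0.
  rewrite (cross_eq0_scale u0 (gen_amax ds gg x1M x2M)) dotBr.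
  rewrite (uc _ x1M) (uc _ x2M) subrr.
  by rewrite mul0r scale0r eqxx.
exists (pface P g), a, b, (dot u (b - a) / dot u u).
have fa := pface_amax hP aM'; have fb := pface_amax hP bM'.
split; last first.
  do 2 split=> //; split; first by apply: vtx aM; rewrite oner_eq0.
  split; first by apply: vtx bM; rewrite oppr_eq0 oner_eq0.
  split; first exact/eqP.
  exact: cross_eq0_scale u0 (gen_amax ds gg bM' aM').
split; first exact: face_pface.
split; first exact: dim_ge1I fa fb ab.
move=> /dim_ge2P[p [q [r [fp fq fr]]]]; apply/negP; rewrite negbK; apply/eqP.
have par x : pface P g x -> cross u (x - a) = 0.
  by move=> fx; apply: (pface_par hP aM' fx) => c cM; exact: gen_amax ds gg cM aM'.
have parp x y : pface P g x -> pface P g y -> cross u (x - y) = 0.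
  move=> /par hx /par hy.
  exact: cross_sub_eq0 hx hy.
by apply: (cross_eq0_trans u0); apply: parp.
Qed.

End Faces.

(** * Unit vectors representing directions *)

Section UnitDirections.
Variable R : realType.
Notation pt := 'rV[R]_3.
Implicit Types (u v w x y z a b : pt) (s D : seq pt).

Definition unit_dir u : Prop := dot u u = 1 /\ first_nonzero_pos u.

Lemma unit_dir_neq0 u : unit_dir u -> u != 0.
Proof. by move=> [u1 _]; rewrite -dotxx_eq0 u1 oner_eq0. Qed.

Definition unitdir x : pt :=
  let y := (Num.sqrt (dot x x))^-1 *: x in
  if (0 < y 0 0) || ((y 0 0 == 0) && ((0 < y 0 1) || (y 0 1 == 0) && (0 < y 0 2)))
  then y else - y.

Lemma unitdirP x : x != 0 -> unit_dir (unitdir x) /\ cross (unitdir x) x = 0.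
Proof.
move=> x0; rewrite /unitdir; set y := _ *: x.
have y1 : dot y y = 1.
  rewrite /y dotZl dotZr mulrA -invfM -expr2 sqr_sqrtr ?dotxx_ge0 //.
  by rewrite mulVf // dotxx_eq0.
have yx : cross y x = 0 by rewrite /y crossZl crossxx scaler0.
have y0 : y != 0 by rewrite -dotxx_eq0 y1 oner_eq0.
case: ifP => [/orP[h|/andP[/eqP h /orP[h'|/andP[/eqP h' h'']]]]|].
- by split=> //; split=> //; left.
- by split=> //; split=> //; right; left.
- by split=> //; split=> //; right; right.
move=> /negbT; rewrite negb_or negb_and negb_or negb_and -!leNgt => /andP[h0 h].
split; last by rewrite crossNl yx oppr0.
split; first by rewrite dotNl dotNr opprK.
rewrite /first_nonzero_pos !oppE !oppr_gt0.
have [E0|n0] := eqVneq (y 0 0) 0; last by left; rewrite lt_neqAle n0.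
move: h; rewrite E0 eqxx /= => /andP[h1 h2].
have [E1|n1] := eqVneq (y 0 1) 0; last first.
  by right; left; rewrite oppr0; split=> //; rewrite lt_neqAle n1 h1.
right; right; rewrite E1 !oppr0; split=> //; split=> //.
move: h2; rewrite E1 eqxx /= => h2; rewrite lt_neqAle h2 andbT.
by apply: contraNneq y0 => E2; apply/eqP/vecP; rewrite zeroE.
Qed.

Lemma unit_dir_inj u v : unit_dir u -> unit_dir v -> cross u v = 0 -> u = v.
Proof.
move=> hu [v1 vp]; have u0 := unit_dir_neq0 hu; move: hu => [u1 up].
move=> /cross_eq0_scale -/(_ u0); rewrite u1 divr1; set k := dot u v => vE.
have kk : k * k = 1 by move: v1; rewrite vE dotZl dotZr u1 mulr1.
have := sqrf_eq1 k; rewrite expr2 kk eqxx => /esym/orP[] /eqP k1.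
  by rewrite vE k1 scale1r.
move: vp up; rewrite vE k1 /first_nonzero_pos !scaleE !mulN1r !oppr_gt0.
by case=> [?|[[? ?]|[? [? ?]]]] [?|[[? ?]|[? [? ?]]]]; exfalso; lra.
Qed.

(** Directions of all differences, edges or not: a finite list without repetitions that contains
    every direction with a hit ([hit_dirs]). *)
Definition dirs s : seq pt :=
  undup [seq unitdir x | x <- [seq a - b | a <- s, b <- s] & x != 0].

Lemma dirs_unit s u : u \in dirs s -> unit_dir u.
Proof.
rewrite mem_undup => /mapP[x]; rewrite mem_filter => /andP[x0 _] ->.
by have [] := unitdirP x0.
Qed.

Lemma dirs_mem s a b : a \in s -> b \in s -> a != b ->
  exists2 u, u \in dirs s & cross u (a - b) = 0.
Proof.
move=> as_ bs ab; have x0 : a - b != 0 by rewrite subr_eq0.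
have [h1 h2] := unitdirP x0; exists (unitdir (a - b)) => //.
rewrite mem_undup; apply: map_f; rewrite mem_filter x0 /=.
by apply/allpairsP; exists (a, b).
Qed.

Lemma hit_dirs s u v : unit_dir u -> hit s u v -> u \in dirs s.
Proof.
move=> hu /hitP[a [b [/amax_sub aM /amax_sub bM ab h]]].
have [u' u's h'] := dirs_mem aM bM ab; have hu' := dirs_unit u's.
rewrite (@unit_dir_inj u u') //; apply: (@cross_eq0_trans _ (a - b)).
- by rewrite subr_eq0.
- by rewrite crossC h oppr0.
- by rewrite crossC h' oppr0.
Qed.

End UnitDirections.

(** * Orthogonal projection along a vector *)

Section Projection.
Variable R : realType.
Notation pt := 'rV[R]_3.
Implicit Types (u v w x y z a b : pt).

Lemma proj_eqP n x y : n != 0 -> proj n x = proj n y <-> cross n (x - y) = 0.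
Proof.
move=> n0; split=> [|/eqP/(cross_eq0P _ n0)[k E]].
  rewrite /proj; move: (_ / _) (dot n y / _) => p q E.
  have -> : x - y = (p - q) *: n.
    rewrite -[x](subrK (p *: n)) E scalerBl addrAC [y - _ - y]addrAC subrr add0r.
    by rewrite addrC.
  exact: cross_scale_eq0.
have -> : x = k *: n + y by rewrite -E subrK.
rewrite /proj dotDr dotZr mulrDl mulfK ?dotxx_eq0 // scalerDl opprD.
by rewrite addrACA subrr add0r.
Qed.

Lemma dot_proj n x y : dot (proj n x) y = dot x (proj n y).
Proof. by rewrite /proj dotBr dotDl dotNl dotZl dotZr (dotC x n); ring. Qed.

Lemma proj_perp n x : n != 0 -> dot n (proj n x) = 0.
Proof. by move=> n0; rewrite /proj dotBr dotZr divfK ?dotxx_eq0 // subrr. Qed.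

Lemma dot_proj_perp n x y : dot n x = 0 -> dot x (proj n y) = dot x y.
Proof. by move=> nx; rewrite -dot_proj /proj nx mul0r scale0r subr0. Qed.

Lemma perp_par n v z : n != 0 -> v != 0 -> dot n v = 0 -> dot v z = 0 ->
  dot (cross n v) z = 0 -> cross n z = 0.
Proof.
move=> n0 v0 nv vz nvz; have h : cross v (cross n v) = dot v v *: n.
  by rewrite cross_crossr (dotC v n) nv scale0r subr0.
have h0 : cross v (cross n v) != 0 by rewrite h scaler_eq0 dotxx_eq0 (negbTE v0).
rewrite dotC in vz; rewrite dotC in nvz.
by rewrite (perp_cross h0 vz nvz) h !crosslE !scaler0.
Qed.

End Projection.

(** * Counting the vertices of a projection *)

Section Count.
Variable R : realType.
Notation pt := 'rV[R]_3.
Implicit Types (u v w x y z a b : pt).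
Variables (P : pset R) (s : seq pt) (n : pt).
Hypothesis hP : seteq P (conv s).
Hypothesis s0 : s != [::].
Hypothesis n0 : n != 0.
Hypothesis full : forall w, w != 0 -> exists a b, [/\ a \in s, b \in s & dot w a != dot w b].
Hypothesis good : forall v, v != 0 -> dot n v = 0 -> forall a b c,
  a \in amax s v -> b \in amax s v -> c \in amax s v -> cross (b - a) (c - a) = 0.

(* Rotate w clockwise in the plane orthogonal to n until the face exposed by w
   grows: rho is the largest slope of a segment from x to another point of s, in
   the frame given by w and cross n w. *)
Lemma rotate w x : w != 0 -> dot n w = 0 -> x \in amax s w ->
  (forall y, y \in amax s w -> cross n (y - x) = 0) ->
  exists v, [/\ v != 0, dot n v = 0, x \in amax (amax s v) (cross n v) &
    exists2 a, a \in amax s v & cross n (x - a) != 0].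
Proof.
move=> w0 nw xM hw; have /amaxP[xs xw] := xM.
pose far := [seq a <- s | cross n (x - a) != 0].
have far0 : far != [::].
  rewrite -has_filter; apply/negPn/negP => /hasPn h.
  have [a [b [as_ bs]]] := full w0; apply/negP; rewrite negbK.
  have E y : y \in s -> dot w y = dot w x.
    move=> /h; rewrite negbK => /eqP/cross_eq0_scale -/(_ n0) E.
    have : dot w (x - y) = 0 by rewrite E dotZr [dot w n]dotC nw mulr0.
    by rewrite dotBr => /eqP; rewrite subr_eq0 => /eqP.
  by rewrite !E.
have J0 : cross n w != 0 by apply: cross_perp_neq0.
pose c a := dot (cross n w) (x - a); pose d a := dot w (x - a).
have d0 a : a \in far -> 0 < d a.
  rewrite mem_filter => /andP[na as_]; rewrite /d dotBr subr_gt0 lt_neqAle xw //.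
  rewrite andbT; apply: contraNneq na => E.
  rewrite -opprB crossNr oppr_eq0; apply/eqP/hw/amaxP; split=> // b bs.
  by rewrite E xw.
have near a : cross n (x - a) = 0 -> c a = 0 /\ d a = 0.
  move=> /cross_eq0_scale -/(_ n0) E; rewrite /c /d E !dotZr.
  by rewrite [dot (cross _ _) _]dotC dot_crossl [dot w n]dotC nw !mulr0.
have [a af amx] := seq_argmax (fun a => c a / d a) far0.
pose rho := c a / d a; pose v := rho *: w - cross n w.
have nv : dot n v = 0 by rewrite /v dotBr dotZr nw dot_crossl mulr0 subr0.
have vd b : dot v (x - b) = rho * d b - c b by rewrite /v dotDl dotNl dotZl.
have nvE : cross n v = rho *: cross n w + dot n n *: w.
  by rewrite /v !crosslE cross_crossr nw scale0r sub0r opprK.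
have nvd b : dot (cross n v) (x - b) = rho * c b + dot n n * d b.
  by rewrite nvE dotDl !dotZl.
have vge b : b \in s -> 0 <= dot v (x - b).
  move=> bs; rewrite vd; have [bf|] := boolP (b \in far).
    by rewrite subr_ge0 -ler_pdivrMr ?d0 //; exact: amx.
  rewrite mem_filter bs andbT negbK => /eqP/near[-> ->].
  by rewrite mulr0 subr0.
have xv : x \in amax s v.
  by apply/amaxP; split=> // b /vge; rewrite dotBr subr_ge0.
have av : a \in amax s v.
  have : dot v (x - a) = 0 by rewrite vd /rho divfK ?subrr // gt_eqF ?d0.
  rewrite dotBr => /eqP; rewrite subr_eq0 => /eqP E.
  by apply/amaxP; split=> [|b bs]; [move: af; rewrite mem_filter => /andP[]|
     rewrite -E; case/amaxP: xv => _; exact].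
exists v; split=> //.
- apply: contraNneq J0 => vE; rewrite -dotxx_eq0.
  have : dot (cross n w) v = 0 by rewrite vE dot0r.
  by rewrite /v dotBr dotZr [dot _ w]dotC dot_crossr mulr0 sub0r => /eqP; rewrite oppr_eq0.
- apply/amaxP; split=> // b bv; rewrite -subr_ge0 -dotBr nvd.
  have [bf|] := boolP (b \in far).
    have : dot v (x - b) = 0 by rewrite dotBr (amax_eq xv bv) subrr.
    rewrite vd => /eqP; rewrite subr_eq0 => /eqP <-.
    rewrite mulrA -mulrDl mulr_ge0 ?(ltW (d0 _ bf)) // addr_ge0 ?dotxx_ge0 //.
    by rewrite -expr2 sqr_ge0.
  rewrite mem_filter (amax_sub bv) andbT negbK => /eqP/near[-> ->].
  by rewrite !mulr0 addr0.
- by exists a => //; move: af; rewrite mem_filter => /andP[].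
Qed.

(** If v exposed a segment parallel to n, rotating v about n until the face grows would expose that
    segment with a point off its line, against [good]. *)
Lemma hit_good v : v != 0 -> dot n v = 0 -> hit s n v = false.
Proof.
move=> v0 nv; apply/negP => /hitP[a [b [aM bM ab hab]]].
have ba0 : b - a != 0 by rewrite subr_eq0 eq_sym.
have hba : cross (b - a) n = 0 by rewrite -opprB crossNl crossC hab !oppr0.
have par v' c : v' != 0 -> dot n v' = 0 -> a \in amax s v' -> b \in amax s v' ->
    c \in amax s v' -> cross n (c - a) = 0.
  move=> v'0 nv' a' b' c'; apply: (cross_eq0_trans ba0 hba).
  exact: good a' b' c'.
have [|v' [v'0 nv' /amax_sub a' [c c' h]]] := rotate v0 nv aM.
  by move=> y yM; exact: par yM.
have b' : b \in amax s v'.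
  have [k E] := cross_eq0P _ n0 (introT eqP hab).
  have : dot v' (a - b) = 0 by rewrite E dotZr [dot v' n]dotC nv' mulr0.
  rewrite dotBr => /eqP; rewrite subr_eq0 => /eqP v'E; case/amaxP: a' => as_ a'.
  by apply/amaxP; split=> [|c0 /a']; [exact: amax_sub bM|rewrite -v'E].
by move: h; rewrite -opprB crossNr (par v') // oppr0 eqxx.
Qed.

Lemma top_vertex v x : v != 0 -> dot n v = 0 -> x \in amax (amax s v) (cross n v) ->
  vertex (proj_set n P) (proj n x).
Proof.
move=> v0 nv xM; have xM' := amax_sub xM; have /ev_ex[e e0 E] := amax_lex s v (cross n v).
set W := v + _ in E; have nW : dot n W = 0.
  by rewrite /W dotDr nv dotZr dot_crossl mulr0 addr0.
have xW : x \in amax s W by rewrite E.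
split; first by exists x; split=> //; apply/hP/conv_mem/(amax_sub xM').
exists W => _ [z [Pz ->]] zx; rewrite !dot_proj_perp //.
have [_ hx] := pface_amax hP xW.
rewrite lt_neqAle hx // andbT; apply/negP => /eqP zE; apply: zx.
apply/(proj_eqP _ _ n0); apply: (pface_par hP xW).
  by split=> // y Py; rewrite zE; exact: hx.
move=> b; rewrite E => bM; apply: (perp_par n0 v0 nv).
  by rewrite dotBr (amax_eq (amax_sub bM) xM') subrr.
by rewrite dotBr (amax_eq bM xM) subrr.
Qed.

Lemma vertex_top p : vertex (proj_set n P) p -> exists v x,
  [/\ v != 0, dot n v = 0, x \in amax (amax s v) (cross n v), p = proj n x &
    exists2 a, a \in amax s v & cross n (x - a) != 0].
Proof.
(* Only the component orthogonal to n acts on the projection, and [rotate] needs a form of this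
   kind. *)
move=> [[z [Pz pE]] [W0 hW]]; pose W := proj n W0.
have hW' y : P y -> proj n y <> p -> dot W y < dot W z.
  by move=> Py yp; rewrite !dot_proj -pE; apply: hW => //; exists y.
have sW y : y \in amax s W -> proj n y = p.
  move=> /amaxP[ys hy]; apply/eqP/negPn/negP => /eqP yp.
  have := hW' _ (proj2 (hP _) (conv_mem ys)) yp; rewrite ltNge.
  by rewrite (conv_le (proj1 (hP z) Pz) hy).
have [x xM] := amax_ex W s0; have xp := sW _ xM.
have par y : y \in amax s W -> cross n (y - x) = 0.
  by move=> /sW yp; apply/(proj_eqP _ _ n0); rewrite yp.
have nW : dot n W = 0 by exact: proj_perp.
(* W = 0 would make all generators project to one point, against [full]. *)
have [WE|Wn] := eqVneq W 0.
  have [w w0 nw] := perp_exists n; have [a [b [as_ bs /negP[]]]] := full w0.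
  have E y : y \in s -> dot w y = dot w x.
    move=> ys; have /par/(cross_eq0_scale n0) E : y \in amax s W.
      by apply/amaxP; split=> // c _; rewrite WE !dot0l.
    have : dot w (y - x) = 0 by rewrite E dotZr [dot w n]dotC nw mulr0.
    by rewrite dotBr => /eqP; rewrite subr_eq0 => /eqP.
  by rewrite !E.
have [v [v0 nv xv av]] := rotate Wn nW xM par.
by exists v, x; split.
Qed.

(** From x, the point y of the edge of v lies strictly backwards along [cross n v]. As v' is maximal
    at the same projected point, it cannot increase towards y. *)
Lemma top_turn v v' x x' y : v != 0 -> dot n v = 0 -> dot n v' = 0 ->
  x \in amax (amax s v) (cross n v) -> x' \in amax s v' ->
  cross n (x - x') = 0 -> y \in amax s v -> cross n (y - x) != 0 ->
  0 <= dot (cross n v) v'.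
Proof.
move=> v0 nv nv' xM x'M xx' yM yx; have xM' := amax_sub xM.
have vy : dot v (y - x) = 0 by rewrite dotBr (amax_eq yM xM') subrr.
have ny : dot (cross n v) (y - x) < 0.
  rewrite lt_neqAle dotBr subr_le0; case/amaxP: xM => _ -> //; rewrite andbT -dotBr.
  by apply: contraNneq yx => E; rewrite (perp_par n0 v0 nv vy E).
have [k E] := cross_eq0P _ n0 (introT eqP xx').
have : dot v' (y - x) <= 0.
  rewrite dotBr subr_le0 (_ : dot v' x = dot v' x').
    by case/amaxP: x'M => _; apply; exact: amax_sub yM.
  by apply/eqP; rewrite -subr_eq0 -dotBr E dotZr dotC nv' mulr0.
rewrite {1}(perp_decomp n0 v0 nv nv') dotDl !dotZl vy mulr0 add0r.
rewrite nmulr_lle0 // pmulr_lge0 // invr_gt0 dotxx_gt0.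
exact: cross_perp_neq0.
Qed.

(** [top_turn] used both ways bounds an antisymmetric expression by 0 on both sides, so the normals
    are proportional. A negative factor would make v both maximal and minimal at x, against
    [full]. *)
Lemma top_inj v v' x x' y y' : v != 0 -> v' != 0 -> dot n v = 0 -> dot n v' = 0 ->
  x \in amax (amax s v) (cross n v) -> x' \in amax (amax s v') (cross n v') ->
  cross n (x - x') = 0 -> y \in amax s v -> cross n (y - x) != 0 ->
  y' \in amax s v' -> cross n (y' - x') != 0 -> exists2 k : R, 0 < k & v' = k *: v.
Proof.
move=> v0 v'0 nv nv' xM x'M xx' yM yx y'M y'x'.
have x'x : cross n (x' - x) = 0 by rewrite -opprB crossNr xx' oppr0.
have h1 := top_turn v0 nv nv' xM (amax_sub x'M) xx' yM yx.
have h2 := top_turn v'0 nv' nv x'M (amax_sub xM) x'x y'M y'x'.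
have E0 : dot (cross n v) v' = 0.
  apply/eqP; rewrite eq_le h1 andbT -oppr_ge0; suff <- : dot (cross n v') v = -
    dot (cross n v) v' by [].
  by rewrite !coordE; ring.
have vE := perp_decomp n0 v0 nv nv'; rewrite E0 mul0r scale0r addr0 in vE.
set k := _ / _ in vE; exists k => //; rewrite ltNge; apply/negP => k0.
have [a [b [as_ bs /negP[]]]] := full v0.
have [r E] := cross_eq0P _ n0 (introT eqP xx').
have xE : dot v x = dot v x'.
  by apply/eqP; rewrite -subr_eq0 -dotBr E dotZr dotC nv mulr0.
have k1 : k < 0.
  by rewrite lt_neqAle k0 andbT; apply: contraNneq v'0 => kE; rewrite vE kE scale0r.
have const c : c \in s -> dot v c = dot v x.
  move=> cs; have /amaxP[_ /(_ _ cs) hx] := amax_sub xM.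
  have /amaxP[_ /(_ _ cs)] := amax_sub x'M; rewrite vE !dotZl ler_nM2l // -xE => hx'.
  by apply/eqP; rewrite eq_le hx hx'.
by rewrite !const.
Qed.

Definition sgv (p : pt * bool) : pt := if p.2 then - cross p.1 n else cross p.1 n.

(** If u is parallel to n, the normal [cross u n] is 0 and exposes everything; [hit] could then hold
    although u gives no edge of the projection. *)
Definition seen u v : bool := (v != 0) && hit s u v.

(* Every edge of the projected polygon, given by its outer normal sgv p, is sent to
   its counterclockwise endpoint; this is a bijection onto the vertices. *)
Definition flags : seq (pt * bool) :=
  [seq p <- [seq (u, e) | u <- dirs s, e <- [:: false; true]] | seen p.1 (sgv p)].

(** The default 0 is never reached ([top_mem]). Several generators may qualify; for non-zero v
    orthogonal to n they share one projection along n. *)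
Definition top v : pt := head 0 (amax (amax s v) (cross n v)).

Lemma top_mem v : top v \in amax (amax s v) (cross n v).
Proof.
have [a aM] := amax_ex v s0; have /(amax_ex (cross n v)) : amax s v != [::].
  by move: aM; case: (amax s v).
by rewrite /top => -[b]; case: (amax _ _) => //= c r _; rewrite mem_head.
Qed.

Lemma sgv_perp p : dot n (sgv p) = 0.
Proof. by rewrite /sgv; case: p.2; rewrite ?dotNr dot_crossr ?oppr0. Qed.

Lemma flags_far p : p.1 != 0 -> seen p.1 (sgv p) ->
  exists2 y, y \in amax s (sgv p) & cross n (y - top (sgv p)) != 0.
Proof.
move=> u0 /andP[v0 /hitP[a [b [aM bM ab /eqP/(cross_eq0P _ u0)[k E]]]]].
have [ha|] := eqVneq (cross n (a - top (sgv p))) 0; last by exists a.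
have [hb|] := eqVneq (cross n (b - top (sgv p))) 0; last by exists b.
have := cross_sub_eq0 ha hb; rewrite E crossZr => /eqP; rewrite scaler_eq0.
have -> : (k == 0) = false.
  by apply: contraNF ab => /eqP k0; rewrite -subr_eq0 E k0 scale0r.
move=> /eqP nu; move: v0; rewrite /sgv crossC nu oppr0.
by case: p.2; rewrite ?oppr0 eqxx.
Qed.

Lemma count_vertices : has_nvertices (proj_set n P)
  (\sum_(u <- dirs s) (seen u (cross u n) + seen u (- cross u n)))%N.
Proof.
exists [seq proj n (top (sgv p)) | p <- flags]; split; last split.
- rewrite map_inj_in_uniq.
    by rewrite filter_uniq // allpairs_uniq ?undup_uniq // => -[a b] [c d] _ _ [-> ->].
  move=> [u b] [u' b']; rewrite !mem_filter => /andP[sp /allpairsP[[u1 b1] [up _ [? ?]]]].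
  move=> /andP[sp' /allpairsP[[u2 b2] [up' _ [? ?]]]]; subst u1 u2 b1 b2.
  move=> /(proj_eqP _ _ n0) xx'; simpl in up, up'.
  have hu := dirs_unit up; have hu' := dirs_unit up'.
  have u0 := unit_dir_neq0 hu; have u'0 := unit_dir_neq0 hu'.
  have [y yM yx] := flags_far (p := (u, b)) u0 sp.
  have [y' y'M y'x] := flags_far (p := (u', b')) u'0 sp'.
  move: sp sp' => /andP[v0 hv] /andP[v'0 hv'].
  have [k k0 vE] := top_inj v0 v'0 (sgv_perp _) (sgv_perp _) (top_mem _) (top_mem _)
    xx' yM yx y'M y'x.
  move: hv => /hitP[a [c [aM cM ac hac]]].
  move: hv'; rewrite vE /hit amax_scale // => /hitP[a' [c' [a'M c'M ac' hac']]].
  (* Both flags expose the same generators, collinear by [good], so the two directions agree. *)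
  have E : cross (a - c) (a' - c') = 0.
    have G x : x \in amax s (sgv (u, b)) -> cross (a - c) (x - c) = 0.
      by move=> xM; exact: (good v0 (sgv_perp _) cM aM xM).
    exact: cross_sub_eq0 (G _ a'M) (G _ c'M).
  have ac0 : a - c != 0 by rewrite subr_eq0.
  have ac'0 : a' - c' != 0 by rewrite subr_eq0.
  have uu' : u = u'.
    apply: unit_dir_inj => //; apply: (cross_eq0_trans ac0).
      by rewrite crossC hac oppr0.
    have E' : cross (a' - c') (a - c) = 0 by rewrite crossC E oppr0.
    by apply: (cross_eq0_trans ac'0) => //; rewrite crossC hac' oppr0.
  (* Opposite signs would give opposite normals, which are not positive multiples of each other. *)
  subst u'; congr (_, _); apply/eqP/negPn/negP => bb'.
  have b'E : b' = ~~ b by move: bb'; case: (b); case: (b').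
  have neg (z : pt) : z != 0 -> - z = k *: z -> False.
    move=> z0 /eqP; rewrite -scaleN1r -subr_eq0 -scalerBl scaler_eq0 (negbTE z0) orbF.
    by rewrite subr_eq0 eq_sym gt_eqF //; lra.
  move: vE v0; rewrite /sgv /= b'E; case: (b) => /= wE.
    by rewrite oppr_eq0 => w0; apply: (neg _ w0); rewrite {1}wE scalerN opprK.
  by move=> w0; exact: neg w0 wE.
- rewrite size_map size_filter -sum1_count big_mkcond big_allpairs /=.
  apply: eq_bigr => u _; rewrite !big_cons big_nil /= addn0 /sgv /=.
  by do 2 case: (seen _ _).
(* Surjectivity: the normal v of an edge at the vertex is orthogonal to n and to the edge direction
   u, hence a multiple of [cross u n]; the sign of the factor selects the flag. *)
move=> p; split=> [/vertex_top[v [x [v0 nv xM pE [a aM xa]]]]|].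
  have xM' := amax_sub xM.
  have ax : x != a by apply: contraNneq xa => ->; rewrite subrr cross0r.
  have [u us hu] := dirs_mem (amax_sub xM') (amax_sub aM) ax.
  have uu := dirs_unit us; have u0 := unit_dir_neq0 uu.
  have [k E] := cross_eq0P _ u0 (introT eqP hu).
  have k0 : k != 0 by apply: contraNneq ax => k0; rewrite -subr_eq0 E k0 scale0r.
  have un : cross u n != 0.
    apply: contraNneq xa => un; rewrite E crossZr crossC un oppr0 scaler0.
    by [].
  have uv : dot v u = 0.
    have : dot v (x - a) = 0 by rewrite dotBr (amax_eq xM' aM) subrr.
    by rewrite E dotZr => /eqP; rewrite mulf_eq0 (negbTE k0) => /eqP.
  have vn : dot v n = 0 by rewrite dotC.
  have vE := perp_cross un uv vn; set l := _ / _ in vE.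
  have l0 : l != 0 by apply: contraNneq v0 => l0; rewrite vE l0 scale0r.
  pose b := l < 0; have [r r0 sE] : exists2 r : R, 0 < r & v = r *: sgv (u, b).
    rewrite /sgv /= /b; case: ltrP => hl; last by exists l => //; rewrite lt0r l0.
    by exists (- l); rewrite ?oppr_gt0 // scaleNr scalerN opprK.
  have aE : amax s (sgv (u, b)) = amax s v by rewrite sE amax_scale.
  have aE' : amax (amax s v) (cross n (sgv (u, b))) = amax (amax s v) (cross n v).
    by rewrite {3}sE crossZr amax_scale.
  apply/mapP; exists (u, b).
    rewrite mem_filter; apply/andP; split; last first.
      by apply/allpairsP; exists (u, b); split=> //=; rewrite !inE; case: (b).
    rewrite /seen /=; apply/andP; split.
      by apply: contraNneq v0 => h; rewrite sE h scaler0.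
    by apply/hitP; exists x, a; rewrite aE.
  rewrite pE; apply/(proj_eqP _ _ n0).
  have tM := top_mem (sgv (u, b)); rewrite aE aE' in tM.
  apply: (perp_par n0 v0 nv).
    by rewrite dotBr (amax_eq xM' (amax_sub tM)) subrr.
  by rewrite dotBr (amax_eq xM tM) subrr.
move=> /mapP[[u b]]; rewrite mem_filter => /andP[/andP[v0 _] _] ->.
exact: (top_vertex v0 (sgv_perp _) (top_mem _)).
Qed.

End Count.

Lemma seq_choice (T : eqType) (D : seq T) (A : T -> nat -> Prop) :
  (forall u, u \in D -> exists c, A u c) ->
  exists c : T -> nat, forall u, u \in D -> A u (c u).
Proof.
elim: D => [|u D IH] h; first by exists (fun=> 0%N).
have [c hc] := h u (mem_head _ _).
have [|c' hc'] := IH; first by move=> v vD; apply: h; rewrite inE vD orbT.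
exists (fun v => if v == u then c else c' v) => v; rewrite inE.
by case: eqP => [-> //|_] /= /hc'.
Qed.

Lemma eq_sum_seq (T : eqType) (r : seq T) (A : pred T) (f g : T -> nat) :
  (forall i, i \in r -> A i -> f i = g i) ->
  (\sum_(i <- r | A i) f i = \sum_(i <- r | A i) g i)%N.
Proof.
move=> h; rewrite big_seq_cond [RHS]big_seq_cond.
by apply: eq_bigr => i /andP[]; exact: h.
Qed.

(** * Equiprojectivity and constancy of the counts *)

Section Equiprojective.
Variable R : realType.
Notation pt := 'rV[R]_3.
Implicit Types (u v w x y z a b g : pt).
Variables (P : pset R) (s d : seq pt).
Hypothesis hP : seteq P (conv s).
Hypothesis s0 : s != [::].
Hypothesis ds : covers d s.

(* The number of edges of direction u seen in the silhouette when the plane of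
   projection meets the plane orthogonal to u along v. *)
Definition hits u v : nat := (hit s u v + hit s u (- v))%N.

Definition hits_const u : Prop :=
  forall v v', gen d u v -> gen d u v' -> hits u v = hits u v'.

Lemma pdim3_full w : pdim P 3 -> w != 0 ->
  exists a b, [/\ a \in s, b \in s & dot w a != dot w b].
Proof.
move=> [d3 _] w0; have [a aM] := amax_ex w s0; have as_ := amax_sub aM.
have [/hasP[b bs ab]|/hasPn h] := boolP (has (fun b => dot w a != dot w b) s).
  by exists a, b.
case: (@dim_ge3N _ P w (dot w a)) => // x /hP sx; apply/eqP; rewrite eq_le.
have E b : b \in s -> dot w b = dot w a by move=> /h; rewrite negbK => /eqP.
rewrite (conv_le sx) => [|b /E -> //].
by rewrite -lerN2 -dotNl (conv_le sx) // => b /E; rewrite dotNl => ->.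
Qed.

Lemma no_facet_good n : (~ exists F, facet P F /\ plane_orth_facet n F) ->
  forall v, v != 0 -> dot n v = 0 -> forall a b c : pt,
  a \in amax s v -> b \in amax s v -> c \in amax s v -> cross (b - a) (c - a) = 0.
Proof.
move=> nF v v0 nv a b c aM bM cM; apply/eqP/negPn/negP => h; apply: nF.
have fa := pface_amax hP aM.
have E x : pface P v x -> dot v x = dot v a.
  move=> [Px hx]; have [Pa ha] := fa; apply/eqP.
  by rewrite eq_le ha ?hx.
exists (pface P v); split; last by exists v, (dot v a); rewrite dotC.
split; first exact: face_pface.
split; last exact: (dim_ge3N v0 E).
exact: dim_ge2I fa (pface_amax hP bM) (pface_amax hP cM) h.
Qed.

Lemma hit_scale u v (k : R) : k != 0 -> hit s (k *: u) v = hit s u v.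
Proof.
move=> k0; apply: eq_has => a; apply: eq_has => b.
by rewrite crossZl scaler_eq0 (negbTE k0).
Qed.

(** A collinear face either is parallel to u and survives whole, or has no hit, and then neither has
    the smaller perturbed face. This carries counts from a non-generic normal [cross u n] to generic
    ones. *)
Lemma hit_perturb u v g : u != 0 -> dot u g = 0 ->
  (forall a b c : pt, a \in amax s v -> b \in amax s v -> c \in amax s v ->
     cross (b - a) (c - a) = 0) ->
  ev (fun e => hit s u (v + e *: g) = hit s u v).
Proof.
move=> u0 ug col; apply: (ev_imp (amax_lex s v g)) => e _ E.
have [hv|hv] := boolP (hit s u v).
  rewrite /hit E amax_const //.
  have [a [b [aM bM ab hab]]] := hitP _ _ _ hv.
  have ab0 : a - b != 0 by rewrite subr_eq0.
  have hab' : cross (a - b) u = 0 by rewrite crossC hab oppr0.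
  move=> x y xM yM; have [k ->] : exists k : R, x - y = k *: u.
    apply/(cross_eq0P _ u0)/eqP/(cross_eq0_trans ab0 hab').
    exact: cross_sub_eq0 (col _ _ _ bM aM xM) (col _ _ _ bM aM yM).
  by rewrite dotZr dotC ug mulr0.
apply/negbTE; apply: contraNN hv => /hitP[a [b []]]; rewrite E.
by move=> /amax_sub aM /amax_sub bM ab h; apply/hitP; exists a, b.
Qed.

Lemma hits_const_equiprojective : pdim P 3 ->
  (forall u, unit_dir u -> hits_const u) -> equiprojective P.
Proof.
move=> P3 hc; have full w := @pdim3_full w P3.
have [c cE] : exists c : pt -> nat, forall u, u \in dirs s ->
    forall v, gen d u v -> hits u v = c u.
  apply: (@seq_choice _ _ (fun u c => forall v, gen d u v -> hits u v = c)).
  move=> u /dirs_unit uu; have [g gg] := gen_ex d (unit_dir_neq0 uu).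
  by exists (hits u g) => v gv; exact: (hc u uu).
exists (\sum_(u <- dirs s) c u)%N; split; first by exists s.
split=> // n n0 /no_facet_good good.
have := count_vertices hP s0 n0 full good.
rewrite (_ : (\sum_(u <- dirs s) _ = \sum_(u <- dirs s) c u)%N) //.
apply: eq_big_seq => u us; have u0 := unit_dir_neq0 (dirs_unit us).
have [g gg] := gen_ex d u0; have [_ ug _] := gg; rewrite /seen.
(* When u is parallel to n, [hit_good] excludes edges of direction u, so c u = 0. *)
have [un|un] := eqVneq (cross u n) 0.
  rewrite un oppr0 eqxx /= -(cE u us g gg) /hits.
  have [k nE] := cross_eq0P _ u0 (introT eqP un).
  have k0 : k != 0 by apply: contraNneq n0 => k0; rewrite nE k0 scale0r.
  have [g0 _ _] := gg.
  have ng : dot n g = 0 by rewrite nE dotZl ug mulr0.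
  have H v : v != 0 -> dot n v = 0 -> hit s u v = false.
    by move=> v0 nv; rewrite -(hit_scale u v k0) -nE; exact: (hit_good n0).
  by rewrite !H // ?dotNr ?ng ?oppr0 // oppr_eq0.
rewrite oppr_eq0 un /=.
have uv : dot u (cross u n) = 0 by rewrite dot_crossl.
have un' : - cross u n != 0 by rewrite oppr_eq0.
have nv : dot n (cross u n) = 0 by rewrite dot_crossr.
have nv' : dot n (- cross u n) = 0 by rewrite dotNr nv oppr0.
have ug' : dot u (- g) = 0 by rewrite dotNr ug oppr0.
have := ev_and (ev_gen uv gg) (ev_and (hit_perturb u0 ug (good _ un nv))
  (hit_perturb u0 ug' (good _ un' nv'))).
move=> /ev_ex[e e0 [ge [<- <-]]]; rewrite -(cE u us _ ge) /hits.
by rewrite scalerN -opprD.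
Qed.

(* The number of edges of direction u' seen along u + e m for small e > 0, where
   m = cross v u. *)
Definition germ u v u' : nat :=
  (hit (amax s (cross u' u)) u' (cross u' (cross v u)) +
   hit (amax s (- cross u' u)) u' (- cross u' (cross v u)))%N.

Lemma hit_amax_lex u v x : ev (fun e => hit s u (v + e *: x) = hit (amax s v) u x).
Proof. by apply: (ev_imp (amax_lex s v x)) => e _; rewrite /hit => ->. Qed.

(** A facet normal orthogonal to u and to [cross v u] is a multiple of v; by genericity of v the
    sides of the facet would then be parallel to u, and the normal zero. *)
Lemma gen_no_facet u v : unit_dir u -> gen d u v ->
  ev (fun e => let n := u + e *: cross v u in
    n != 0 /\ ~ exists F, facet P F /\ plane_orth_facet n F).
Proof.
move=> uu [v0 uv gv]; have u0 := unit_dir_neq0 uu; have [u1 _] := uu.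
have mE : cross u (cross v u) = v.
  by rewrite cross_crossr u1 uv scale1r scale0r subr0.
have h1 : ev (fun e => dot u u + e * dot u (cross v u) != 0).
  by apply: ev_neq0; left; rewrite u1 oner_eq0.
have : ev (fun e => forall a, a \in s -> forall b, b \in s -> forall c, c \in s ->
    cross (b - a) (c - a) != 0 ->
    dot (cross (b - a) (c - a)) u + e * dot (cross (b - a) (c - a)) (cross v u) != 0).
  apply: ev_all => a as_; apply: ev_all => b bs; apply: ev_all => c cs.
  have [r0|] := boolP (cross (b - a) (c - a) != 0); last by exists 1; split.
  suff /ev_neq0 h : dot (cross (b - a) (c - a)) u != 0 \/
      dot (cross (b - a) (c - a)) (cross v u) != 0 by apply: (ev_imp h).
  apply/orP; rewrite -negb_and; apply/negP => /andP[/eqP ru /eqP rm].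
  have m0 : cross u (cross v u) != 0 by rewrite mE.
  have := perp_cross m0 ru rm; set k := _ / _; rewrite mE => rE.
  have k0 : k != 0 by apply: contraNneq r0 => k0; rewrite rE k0 scale0r.
  have par x : dot x (cross (b - a) (c - a)) = 0 -> x \in d -> cross u x = 0.
    rewrite rE dotZr => /eqP; rewrite mulf_eq0 (negbTE k0) /= => /eqP xv xd.
    by apply/eqP/negPn/negP => /(gv x xd); rewrite dotC xv eqxx.
  move/negP: r0; apply; apply/eqP; apply: (cross_eq0_trans u0).
    by apply: par (ds bs as_); rewrite dot_crossl.
  by apply: par (ds cs as_); rewrite dot_crossr.
move=> /(ev_and h1) h; apply: (ev_imp h) => e _ [nu he] n.
have n0 : n != 0.
  by apply: contraNneq nu => nE; rewrite -dotZr -dotDr -/n nE dot0r.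
split=> // -[F [[[w hF] [d2 _]] [w' [k [w'0 [w'n w'F]]]]]].
have [a aM] := amax_ex w s0; have as_ := amax_sub aM.
have [/hasP[b bM /hasP[c cM r0]]|/hasPn col] := boolP (has (fun b =>
  has (fun c => cross (b - a) (c - a) != 0) (amax s w)) (amax s w)).
  have := he _ as_ _ (amax_sub bM) _ (amax_sub cM) r0.
  rewrite -dotZr -dotDr -/n.
  have w'E x : x \in amax s w -> dot w' x = k.
    by move=> /(pface_amax hP)/hF/w'F.
  have w'b : dot w' (b - a) = 0 by rewrite dotBr !w'E // subrr.
  have w'c : dot w' (c - a) = 0 by rewrite dotBr !w'E // subrr.
  move: w'n w'0; rewrite (perp_cross r0 w'b w'c); set l := _ / _.
  rewrite dotZl => /eqP; rewrite mulf_eq0 => /orP[/eqP ->|/eqP ->].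
    by rewrite scale0r eqxx.
  by rewrite eqxx.
(* Collinear generators would make the whole face collinear, against its dimension. *)
have col' b c : b \in amax s w -> c \in amax s w -> cross (b - a) (c - a) = 0.
  by move=> /col/hasPn h' /h'; rewrite negbK => /eqP.
have colF b x : b \in amax s w -> pface P w x -> cross (b - a) (x - a) = 0.
  by move=> bM fx; apply: (pface_par hP aM fx) => c cM; exact: col'.
have colFF x y : pface P w x -> pface P w y -> cross (x - a) (y - a) = 0.
  move=> fx fy; apply: (pface_par hP aM fy) => b bM.
  by rewrite crossC colF // oppr0.
have [p [q [r [/hF fp /hF fq /hF fr]]]] := dim_ge2P d2; apply/negP; rewrite negbK.
have -> : cross (q - p) (r - p) =
    cross (q - a) (r - a) - cross (q - a) (p - a) - cross (p - a) (r - a).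
  by apply/vecP; rewrite !coordE; ring.
by rewrite !colFF // !subr0.
Qed.

Lemma equiprojective_germ k u v : k_equiprojective P k -> unit_dir u ->
  u \in dirs s -> gen d u v ->
  k = (hits u v + \sum_(u' <- dirs s | u' != u) germ u v u')%N.
Proof.
move=> [_ [P3 hk]] uu us gv; have full w := @pdim3_full w P3.
have [v0 uv _] := gv; have [u1 _] := uu; set m := cross v u.
have mE : cross u m = v by rewrite cross_crossr u1 uv scale1r scale0r subr0.
have hg : ev (fun e => forall u', u' \in dirs s -> u' != u ->
    (seen s u' (cross u' (u + e *: m)) + seen s u' (- cross u' (u + e *: m)))%N =
    germ u v u').
  apply: ev_all => u' u's; have [u'u|] := boolP (u' != u); last by exists 1; split.
  have c0 : cross u' u != 0.
    by apply: contraNneq u'u => /(unit_dir_inj (dirs_unit u's) uu) ->.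
  have h1 : ev (fun e => dot (cross u' u) (cross u' u) +
      e * dot (cross u' u) (cross u' m) != 0).
    by apply: ev_neq0; left; rewrite dotxx_eq0.
  have h2 := hit_amax_lex u' (cross u' u) (cross u' m).
  have h3 := hit_amax_lex u' (- cross u' u) (- cross u' m).
  apply: (ev_imp (ev_and h1 (ev_and h2 h3))) => e e0 [e1 [e2 e3]] _.
  have nE : cross u' (u + e *: m) = cross u' u + e *: cross u' m.
    by rewrite crossDr crossZr.
  have n0 : cross u' (u + e *: m) != 0.
    by apply: contraNneq e1 => E; rewrite -dotZr -dotDr -nE E dot0r.
  rewrite /seen oppr_eq0 n0 /= /germ -/m -e2 -e3 nE.
  by rewrite opprD scalerN.
have /ev_ex[e e0 [{}hg [n0 nF]]] := ev_and hg (gen_no_facet uu gv).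
have [l [lu [lk lP]]] := hk _ n0 nF.
have [l' [l'u [l'k l'P]]] := count_vertices hP s0 n0 full (no_facet_good nF).
have -> : k = size l'.
  rewrite -lk; apply/perm_size/uniq_perm => //.
  by move=> x; apply/idP/idP => [/lP/l'P|/l'P/lP].
(* For u itself the normal [cross u (u + e *: m)] is e v, so its term is [hits u v]. *)
rewrite l'k (bigD1_seq u) ?undup_uniq //=; congr (_ + _)%N.
  rewrite -/m crossDr crossxx add0r crossZr mE /seen /hits oppr_eq0.
  rewrite scaler_eq0 negb_or gt_eqF // v0 /= -scalerN.
  by rewrite /hit !amax_scale.
exact: eq_sum_seq.
Qed.

(** On a face exposed by w or -w the form w is constant, so only the sign of l matters, and the sum
    over x and -x erases it. *)
Lemma hit_tie v (k l : R) u w x : l != 0 -> x = k *: w + l *: cross u w ->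
  (v == w) || (v == - w) ->
  (hit (amax s v) u x + hit (amax s v) u (- x) =
   hit (amax s v) u (cross u w) + hit (amax s v) u (- cross u w))%N.
Proof.
move=> l0 -> vw.
have tie a b : a \in amax s v -> b \in amax s v -> dot w a = dot w b.
  move=> aM bM; have := amax_eq aM bM; case/orP: vw => /eqP -> //.
  by rewrite !dotNl => /oppr_inj.
have E (j : R) y : amax (amax s v) (j *: w + y) = amax (amax s v) y.
  by apply: eq_amax => a b aM bM; rewrite !dotDl !dotZl (tie _ _ aM bM) lerD2l.
have {}E (j : R) y : hit (amax s v) u (j *: w + y) = hit (amax s v) u y.
  by rewrite /hit E.
have pos (j : R) y : 0 < j -> hit (amax s v) u (j *: y) = hit (amax s v) u y.
  by move=> j0; rewrite /hit amax_scale.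
rewrite opprD -scaleNr !E; have [l1|l1] := ltrP l 0; last first.
  by rewrite -scalerN !pos // lt0r l0.
have lE y : l *: y = (- l) *: (- y) by rewrite scaleNr scalerN opprK.
by rewrite lE -scalerN !pos ?oppr_gt0 // opprK addnC.
Qed.

(* Independent of v: crossing u exchanges the two sides of the line spanned by
   cross u' u in the plane orthogonal to u'. *)
Definition germ_sum u u' : nat :=
  (let c := cross u' u in let w := cross u' c in
   (hit (amax s c) u' w + hit (amax s c) u' (- w)) +
   (hit (amax s (- c)) u' w + hit (amax s (- c)) u' (- w)))%N.

(** Replacing v by -v reverses x = [cross u' (cross v u)], so both x and -x are counted on each of
    the faces exposed by c and -c; [hit_tie] removes what is left of v. *)
Lemma germ_opp u v u' : unit_dir u -> u' \in dirs s -> u' != u -> gen d u v ->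
  (germ u v u' + germ u (- v) u')%N = germ_sum u u'.
Proof.
move=> uu u's u'u [v0 uv gv]; pose c := cross u' u; pose w := cross u' c.
have uu' := dirs_unit u's.
have [u1 _] := uu; have [u'1 _] := uu'; have u'0 := unit_dir_neq0 uu'.
have u0 := unit_dir_neq0 uu.
have c0 : c != 0 by apply: contraNneq u'u => /(unit_dir_inj uu' uu) ->.
(* u' is the direction of a listed difference not parallel to u, and v is generic. This makes the
   coefficient l below non-zero. *)
have u'v : dot u' v != 0.
  move: u's; rewrite mem_undup => /mapP[x]; rewrite mem_filter => /andP[x0 xs] u'E.
  have [_ hx] := unitdirP x0; rewrite -u'E in hx.
  have xd : x \in d by case/allpairsP: xs => -[a b] /= [as_ bs ->]; exact: ds.
  have [k xE] := cross_eq0P _ u'0 (introT eqP hx).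
  have k0 : k != 0 by apply: contraNneq x0 => k0; rewrite xE k0 scale0r.
  have : dot v x != 0.
    apply: gv => //; rewrite xE crossZr scaler_eq0 (negbTE k0) /= crossC oppr_eq0.
    exact: c0.
  by rewrite xE dotZr mulf_eq0 (negbTE k0) dotC.
set x := cross u' (cross v u).
have xE := perp_decomp u'0 c0 (dot_crossl _ _) (dot_crossl u' (cross v u)).
rewrite -/x -/w in xE.
have wx : dot w x = dot u' v.
  have -> : dot w x = dot u' u' * (dot u' v * dot u u - dot u' u * dot u v)
    - dot u' (cross v u) * dot u' c by rewrite /w /x /c !coordE; ring.
  by rewrite u'1 u1 uv /c dot_crossl; ring.
have w0 : w != 0 by apply: cross_perp_neq0; rewrite // dot_crossl.
set k := dot c x / _ in xE; set l := dot w x / _ in xE.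
have l0 : l != 0 by rewrite /l mulf_neq0 ?invr_eq0 ?dotxx_eq0 // wx.
have c1 : (c == c) || (c == - c) by rewrite eqxx.
have c2 : (- c == c) || (- c == - c) by rewrite eqxx orbT.
apply: etrans (congr2 addn (hit_tie l0 xE c1) (hit_tie l0 xE c2)).
rewrite /germ crossNl crossNr -/x -/c opprK addnACA.
by congr addn; rewrite addnC.
Qed.

Lemma equiprojective_hits_const u : equiprojective P -> unit_dir u -> hits_const u.
Proof.
move=> [k hk] uu v v' gv gv'; have [us|us] := boolP (u \in dirs s); last first.
  have H x : hit s u x = false by apply: contraNF us => /(hit_dirs uu).
  by rewrite /hits !H.
(* The equations for x and -x add up to 2k: twice the count at x plus a sum that does not involve
   x. *)
have K x : gen d u x ->
    (k + k = (hits u x + hits u x) + \sum_(u' <- dirs s | u' != u) germ_sum u u')%N.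
  move=> gx; have h1 := equiprojective_germ hk uu us gx.
  have h2 := equiprojective_germ hk uu us (gen_opp gx).
  have hE : hits u (- x) = hits u x by rewrite /hits opprK addnC.
  rewrite hE in h2; apply: (etrans (congr2 addn h1 h2)).
  rewrite addnACA -big_split; congr addn.
  by apply: eq_sum_seq => u' us' uu'; exact: germ_opp.
have := etrans (esym (K _ gv)) (K _ gv') => /addIn; rewrite !addnn.
exact: double_inj.
Qed.

Lemma flat_hits_const u w : u != 0 -> w != 0 ->
  (forall a b, a \in s -> b \in s -> dot w (a - b) = 0) -> hits_const u.
Proof.
move=> u0 w0 hw v v' gv gv'.
have [uw|uw] := eqVneq (dot u w) 0; last first.
  suff H x : hit s u x = false by rewrite /hits !H.
  apply/negP => /hitP[a [b [/amax_sub as_ /amax_sub bs ab /eqP/(cross_eq0P _ u0)[k E]]]].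
  have := hw _ _ as_ bs; rewrite E dotZr dotC => /eqP.
  rewrite mulf_eq0 (negbTE uw) orbF => /eqP k0.
  by move: ab; rewrite -subr_eq0 E k0 scale0r eqxx.
(* If all generators lie on a line parallel to u, every normal orthogonal to u exposes all of
   them. *)
have [/hasP[a as_ /hasP[b bs ab]]|/hasPn par] :=
  boolP (has (fun a => has (fun b => cross u (a - b) != 0) s) s); last first.
  have H x : dot u x = 0 -> hit s u x = hit s u 0.
    move=> ux; rewrite /hit !amax_const // => a b as_ bs; rewrite ?dot0l //.
    have := par a as_ => /hasPn/(_ b bs); rewrite negbK => /(cross_eq0P _ u0)[k ->].
    by rewrite dotZr dotC ux mulr0.
  have [[_ uv _] [_ uv' _]] := (gv, gv').
  by rewrite /hits !(H v) ?(H v') ?(H (- v)) ?(H (- v')) // dotNr ?uv ?uv' oppr0.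
(* w is constant on the generators, so only the sign of the component of x along z matters;
   genericity, tested on a - b, makes it non-zero. *)
pose z := cross u w.
suff H x : gen d u x -> hits u x = (hit s u z + hit s u (- z))%N by rewrite !H.
move=> [_ ux gx]; have xab := gx _ (ds as_ bs) ab.
have xE := perp_decomp u0 w0 uw ux; rewrite -/z in xE.
set k := dot w x / _ in xE; set l := dot z x / _ in xE.
have l0 : l != 0.
  by apply: contraNneq xab => l0; rewrite xE l0 scale0r addr0 dotZl hw // mulr0.
have E (j : R) y : amax s (j *: w + y) = amax s y.
  apply: eq_amax => p q ps qs; rewrite !dotDl !dotZl.
  by have /eqP := hw _ _ ps qs; rewrite dotBr subr_eq0 => /eqP ->; rewrite lerD2l.
have {}E (j : R) y : hit s u (j *: w + y) = hit s u y by rewrite /hit E.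
have pos (j : R) y : 0 < j -> hit s u (j *: y) = hit s u y.
  by move=> j0; rewrite /hit amax_scale.
rewrite /hits xE opprD -scaleNr !E; have [l1|l1] := ltrP l 0; last first.
  by rewrite -scalerN !pos // lt0r l0.
have lE y : l *: y = (- l) *: (- y) by rewrite scaleNr scalerN opprK.
by rewrite lE -scalerN !pos ?oppr_gt0 // opprK addnC.
Qed.

Lemma admissible_hits_const u : admissible P -> unit_dir u -> hits_const u.
Proof.
move=> [_ hA] uu; have u0 := unit_dir_neq0 uu.
have sP a : a \in s -> P a by move=> as_; exact/hP/conv_mem.
case: hA => [eP|hd]; first exact: equiprojective_hits_const.
have [|w w0 hw] := flat_normal s0 sP; last exact: flat_hits_const hw.
by case: hd => -[_ h]; [right|left].
Qed.

End Equiprojective.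

(** * Minkowski sums *)

Section Minkowski.
Variable R : realType.
Notation pt := 'rV[R]_3.
Implicit Types (u v w x y z a b g : pt) (s t d : seq pt) (P Q : pset R).

Definition msum s t : seq pt := [seq a + b | a <- s, b <- t].

Lemma msumP s t c :
  reflect (exists a b, [/\ a \in s, b \in t & c = a + b]) (c \in msum s t).
Proof.
apply: (iffP allpairsP) => [[[a b] /= [as_ bt ->]]|[a [b [as_ bt ->]]]].
  by exists a, b.
by exists (a, b).
Qed.

Lemma convex_preim (C : pset R) y : convex C -> convex (fun x => C (x + y)).
Proof.
move=> cC p q k k0 k1 Cp Cq; have := cC _ _ k k0 k1 Cp Cq.
by rewrite !scalerDr addrACA -scalerDl [k + _]addrC subrK scale1r.
Qed.

Lemma minkowski_conv P Q s t : seteq P (conv s) -> seteq Q (conv t) ->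
  seteq (minkowski P Q) (conv (msum s t)).
Proof.
move=> hP hQ z; split=> [[x [y [/hP sx [/hQ ty ->]]]]|].
  have st a b : a \in s -> b \in t -> conv (msum s t) (a + b).
    by move=> as_ bt; apply/conv_mem/msumP; exists a, b.
  have cst := @conv_convex R (msum s t).
  have xt b : b \in t -> conv (msum s t) (x + b).
    by move=> bt; apply: (conv_sub (convex_preim (y := b) cst) _ sx) => a as_; exact: st.
  rewrite addrC; apply: (conv_sub (convex_preim (y := x) cst) _ ty) => b bt.
  by rewrite addrC; exact: xt.
apply: conv_sub => [p q k k0 k1 [x [y [Px [Qy ->]]]] [x' [y' [Px' [Qy' ->]]]]|c].
  exists (k *: x + (1 - k) *: x'), (k *: y + (1 - k) *: y'); split; last split.
  - by apply/hP/conv_convex => //; exact/hP.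
  - by apply/hQ/conv_convex => //; exact/hQ.
  - by rewrite !scalerDr addrACA.
move=> /msumP[a [b [as_ bt ->]]]; exists a, b.
by split; [exact/hP/conv_mem|split=> //; exact/hQ/conv_mem].
Qed.

Lemma msum_neq0 s t : s != [::] -> t != [::] -> msum s t != [::].
Proof. by case: s t => [|a s] [|b t]. Qed.

Lemma covers_msuml d s t : t != [::] -> covers d (msum s t) -> covers d s.
Proof.
move=> t0 h a b as_ bs; have [c /amax_sub ct] := amax_ex 0 t0.
have := h (a + c) (b + c); rewrite opprD addrACA subrr addr0; apply.
  by apply/msumP; exists a, c.
by apply/msumP; exists b, c.
Qed.

Lemma covers_msumr d s t : s != [::] -> covers d (msum s t) -> covers d t.
Proof.
move=> s0 h a b at_ bt; have [c /amax_sub cs] := amax_ex 0 s0.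
have := h (c + a) (c + b); rewrite opprD addrACA subrr add0r; apply.
  by apply/msumP; exists c, a.
by apply/msumP; exists c, b.
Qed.

Lemma amax_msum s t v c : s != [::] -> t != [::] ->
  c \in amax (msum s t) v <->
  exists a b, [/\ a \in amax s v, b \in amax t v & c = a + b].
Proof.
move=> s0 t0; split=> [/amaxP[/msumP[a [b [as_ bt ->]]] h]|].
  exists a, b; split=> //; apply/amaxP; split=> // x xs.
    have /h : x + b \in msum s t by apply/msumP; exists x, b.
    by rewrite !dotDr lerD2r.
  have /h : a + x \in msum s t by apply/msumP; exists a, x.
  by rewrite !dotDr lerD2l.
move=> [a [b [/amaxP[as_ ha] /amaxP[bt hb] ->]]]; apply/amaxP; split.
  by apply/msumP; exists a, b.
by move=> x /msumP[p [q [ps qt ->]]]; rewrite !dotDr lerD ?ha ?hb.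
Qed.

(** The face of a sum is the sum of the faces. For generic v both are points or segments parallel to
    u, so the sum is a segment exactly when one of them is. *)
Lemma hit_msum d s t u v : s != [::] -> t != [::] -> covers d (msum s t) ->
  gen d u v -> hit (msum s t) u v = hit s u v || hit t u v.
Proof.
move=> s0 t0 dst gv; have ds := covers_msuml t0 dst; have dt := covers_msumr s0 dst.
have [p pM] := amax_ex v s0; have [q qM] := amax_ex v t0.
apply/idP/orP => [/hitP[x [y [xM yM xy h]]]|[|] /hitP[a [b [aM bM ab h]]]].
- move/(amax_msum _ _ s0 t0): xM => [a [b [aM bM xE]]].
  move/(amax_msum _ _ s0 t0): yM => [a' [b' [a'M b'M yE]]].
  have [aa|aa] := eqVneq a a'; last first.
    by left; apply/hitP; exists a, a'; split=> //; exact: gen_amax ds gv aM a'M.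
  right; apply/hitP; exists b, b'; split=> //; last exact: gen_amax dt gv bM b'M.
  by apply: contraNneq xy => bb; rewrite xE yE aa bb.
- apply/hitP; exists (a + q), (b + q); split.
  + by apply/(amax_msum _ _ s0 t0); exists a, q.
  + by apply/(amax_msum _ _ s0 t0); exists b, q.
  + by rewrite (inj_eq (addIr q)).
  + by rewrite opprD addrACA subrr addr0.
- apply/hitP; exists (p + a), (p + b); split.
  + by apply/(amax_msum _ _ s0 t0); exists p, a.
  + by apply/(amax_msum _ _ s0 t0); exists p, b.
  + by rewrite (inj_eq (addrI p)).
  + by rewrite opprD addrACA subrr add0r.
Qed.

Lemma agg_cone_eq P Q s t d u : seteq P (conv s) -> s != [::] -> covers d s ->
  seteq Q (conv t) -> t != [::] -> covers d t -> u != 0 ->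
  seteq (agg_cone P u) (agg_cone Q u) <->
  (forall g, gen d u g -> hit s u g = hit t u g).
Proof.
move=> hP s0 ds hQ t0 dt u0.
have P1 g := @agg_cone_gen _ P s d u g hP s0 ds u0.
have Q1 g := @agg_cone_gen _ Q t d u g hQ t0 dt u0.
split=> [h g gg|h v].
  by apply/idP/idP => /[dup] hg; [move=> /(P1 _ gg)/h/(Q1 _ gg)|
    move=> /(Q1 _ gg)/h/(P1 _ gg)].
have k1 : (1 : R) = 1 \/ (1 : R) = -1 by left.
have h1 := agg_cone_sub hP s0 ds hQ t0 dt u0 k1.
have h2 := agg_cone_sub hQ t0 dt hP s0 ds u0 k1.
by split=> hv; rewrite -[v]scale1r; [apply: h1|apply: h2] => // g gg;
  rewrite scale1r h.
Qed.

Lemma agg_cone_opp P Q s t d u : seteq P (conv s) -> s != [::] -> covers d s ->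
  seteq Q (conv t) -> t != [::] -> covers d t -> u != 0 ->
  seteq (agg_cone P u) (neg_set (agg_cone Q u)) <->
  (forall g, gen d u g -> hit s u g = hit t u (- g)).
Proof.
move=> hP s0 ds hQ t0 dt u0.
have P1 g := @agg_cone_gen _ P s d u g hP s0 ds u0.
have Q1 g := @agg_cone_gen _ Q t d u g hQ t0 dt u0.
split=> [h g gg|h v].
  have gg' := gen_opp gg.
  by apply/idP/idP => [/(P1 _ gg)/h/(Q1 _ gg')|/(Q1 _ gg')/h/(P1 _ gg)].
have k1 : (-1 : R) = 1 \/ (-1 : R) = -1 by right.
have h1 := agg_cone_sub hP s0 ds hQ t0 dt u0 k1.
have h2 := agg_cone_sub hQ t0 dt hP s0 ds u0 k1.
rewrite /neg_set; split=> hv.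
  by rewrite -scaleN1r; apply: h1 => // g gg; rewrite scaleN1r h.
rewrite -[v]opprK -scaleN1r; apply: h2 => // g gg.
by rewrite scaleN1r h ?opprK //; exact: gen_opp.
Qed.

End Minkowski.

(** * Deciding when the union of two cones has a constant count *)

Theorem theorem4p3 (R : realType) (P Q : pset R) :
  admissible P -> admissible Q -> pdim (minkowski P Q) 3 ->
  (equiprojective (minkowski P Q) <->
   forall u : 'rV[R]_3, edge_direction P u -> edge_direction Q u ->
     (seteq (agg_cone P u) (orth_plane u) \/ seteq (agg_cone Q u) (orth_plane u))
     \/ (seteq (agg_cone P u) (agg_cone Q u) \/
         seteq (agg_cone P u) (neg_set (agg_cone Q u)))).
Proof.
move=> aP aQ d3; have [[s [s0 hP]] _] := aP; have [[t [t0 hQ]] _] := aQ.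
have hPQ := minkowski_conv hP hQ; have st0 := msum_neq0 s0 t0.
pose d := [seq a - b | a <- msum s t, b <- msum s t].
have dst : covers d (msum s t) by move=> a b ha hb; apply/allpairsP; exists (a, b).
have ds := covers_msuml t0 dst; have dt := covers_msumr s0 dst.
have cP u (uu : unit_dir u) := admissible_hits_const hP s0 ds aP uu.
have cQ u (uu : unit_dir u) := admissible_hits_const hQ t0 dt aQ uu.
have hst u g (gg : gen d u g) := hit_msum s0 t0 dst gg.
split=> [ePQ u|h].
  move=> eP eQ; have uu : unit_dir u by case: eP => ? [].
  have [u1 up] := uu; have u0 := unit_dir_neq0 uu.
  have {eP} [gP ggP hgP] := proj1 (edge_direction_hit hP s0 ds u1 up) eP.
  have {eQ} [gQ ggQ hgQ] := proj1 (edge_direction_hit hQ t0 dt u1 up) eQ.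
  have cPQ := equiprojective_hits_const hPQ st0 dst ePQ uu.
  rewrite (agg_cone_full hP s0 ds u0) (agg_cone_full hQ t0 dt u0).
  rewrite (agg_cone_eq hP s0 ds hQ t0 dt u0) (agg_cone_opp hP s0 ds hQ t0 dt u0).
  have {}cP g := cP u uu g gP ^~ ggP; have {}cQ g := cQ u uu g gQ ^~ ggQ.
  have {}cPQ g := cPQ g gP ^~ ggP; rewrite /hits hgP in cP; rewrite /hits hgQ in cQ.
  rewrite /hits (hst _ _ ggP) (hst _ _ (gen_opp ggP)) hgP in cPQ.
  (* If gP and -gP both hit, the constant count is 2 and every generic vector hits, so the cone is
     full; likewise for Q. *)
  have [fP|nP] := boolP (hit s u (- gP)).
    left; left=> g gg; have := cP g gg; rewrite fP.
    by case: (hit s u g) => //=; case: hit.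
  have [fQ|nQ] := boolP (hit t u (- gQ)).
    left; right=> g gg; have := cQ g gg; rewrite fQ.
    by case: (hit t u g) => //=; case: hit.
  rewrite (negbTE nP) /= in cP cPQ; rewrite (negbTE nQ) in cQ; right.
  (* Both counts are now 1. At gP the count of the sum is 2 if -gP hits Q and 1 otherwise; being
     constant, it makes the cones opposite in the first case and equal in the second. *)
  have [f|f] := boolP (hit t u (- gP)); rewrite ?f ?(negbTE f) /= in cPQ.
    right=> g gg; have := cPQ g gg; rewrite (hst _ _ gg) (hst _ _ (gen_opp gg)).
    have := cP g gg; have := cQ g gg.
    by case: (hit s u g); case: (hit t u g); case: hit; case: hit.
  left=> g gg; have := cPQ g gg; rewrite (hst _ _ gg) (hst _ _ (gen_opp gg)).
  have := cP g gg; have := cQ g gg.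
  by case: (hit s u g); case: (hit t u g); case: hit; case: hit.
apply: (hits_const_equiprojective hPQ st0 (d := d)) => // u uu v v' gv gv'.
have [u1 up] := uu; have u0 := unit_dir_neq0 uu.
have HP := cP u uu _ _ gv gv'; have HQ := cQ u uu _ _ gv gv'.
have [gm gm'] := (gen_opp gv, gen_opp gv').
rewrite /hits (hst _ _ gv) (hst _ _ gv') (hst _ _ gm) (hst _ _ gm').
rewrite /hits in HP HQ.
(* By constancy, a count of 0 at one generic vector excludes hits at all of them: either u is an
   edge direction or P contributes nothing. *)
have noP : (exists2 g, gen d u g & hit s u g) \/ forall g, gen d u g -> hit s u g = false.
  have [g gg] := gen_ex d u0; case hg: (hit s u g); first by left; exists g.
  case hg': (hit s u (- g)); first by left; exists (- g) => //; exact: gen_opp.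
  right=> g' gg'; have := cP u uu _ _ gg' gg; rewrite /hits hg hg'.
  by case: (hit s u g').
have noQ : (exists2 g, gen d u g & hit t u g) \/ forall g, gen d u g -> hit t u g = false.
  have [g gg] := gen_ex d u0; case hg: (hit t u g); first by left; exists g.
  case hg': (hit t u (- g)); first by left; exists (- g) => //; exact: gen_opp.
  right=> g' gg'; have := cQ u uu _ _ gg' gg; rewrite /hits hg hg'.
  by case: (hit t u g').
case: noP => [/(edge_direction_hit hP s0 ds u1 up) eP|nP]; last by rewrite !nP.
case: noQ => [/(edge_direction_hit hQ t0 dt u1 up) eQ|nQ]; last by rewrite !nQ // !orbF.
case: (h u eP eQ) => [[/(agg_cone_full hP s0 ds u0) f|/(agg_cone_full hQ t0 dt u0) f]|].
- by rewrite !f.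
- by rewrite !f // !orbT.
case=> [/(agg_cone_eq hP s0 ds hQ t0 dt u0) f|/(agg_cone_opp hP s0 ds hQ t0 dt u0) f].
  by rewrite !f // !orbb -!f.
(* For opposite cones, a generic vector hits the sum iff it or its opposite hits Q, so the count of
   Q decides. *)
rewrite !f // !opprK; rewrite !f // !opprK in HP.
move: HP; by do 4 case: hit.
Qed.
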